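(* If there exists a $\mathcal K$-Lusin set of cardinality $\mathfrak d$, then for any ordinal $\lambda$ the following conditions are equivalent: (1) $\lambda$ is equal to the scattered height of some uncountable FLS space; (2) $2\le\lambda<\mathfrak c^+$, $\mathrm{cf}(\lambda)\le\omega$ and $\mathrm{cf}(\lim\lambda)\le\mathfrak d$.
   Context: $\mathfrak c$ is the cardinality of the continuum and $\mathfrak c^+$ its successor cardinal. For $f,g\in\omega^\omega$, $f\le^* g$ means $f(n)\le g(n)$ for all but finitely many $n$. $\mathfrak d$ is the least cardinality of a subset $D\subseteq\omega^\omega$ such that for every $f\in\omega^\omega$ there is $g\in D$ with $f\le^* g$. $\omega^\omega$ carries the product topology ($\omega$ discrete). A $\mathcal K$-Lusin set is a set $L\subseteq\omega^\omega$ such that $K\cap L$ is countable for every compact $K\subseteq\omega^\omega$. Every ordinal $\lambda$ is uniquely $\lambda=\mu+n$ with $\mu$ a limit ordinal ($0$ counts as limit) and $n\in\omega$; $\lim\lambda:=\mu$. $\mathrm{cf}$ is cofinality, with $\mathrm{cf}(0)=0$ and $\mathrm{cf}(\lambda)=1$ for successor $\lambda$. All spaces are Hausdorff topological spaces. For a space $X$, $X^{(1)}$ is the set of non-isolated points of $X$; $X^{(0)}=X$ and $X^{(\alpha)}=\bigcap_{\xi<\alpha}(X^{(\xi)})^{(1)}$ for ordinals $\alpha>0$. $X$ is scattered if every nonempty subspace has an isolated point; the scattered height of a scattered space $X$ is the smallest ordinal $\alpha$ with $X^{(\alpha)}=\emptyset$. An FLS space is a first-countable Lindelöf scattered (Hausdorff)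 space. *)

(* Defs.v *)
From HB Require Import structures.
From mathcomp Require Import all_boot all_order all_algebra.
From mathcomp Require Import wochoice all_classical topology.

Set Implicit Arguments.
Unset Strict Implicit.
Unset Printing Implicit Defensive.

Local Open Scope classical_set_scope.
Local Open Scope card_scope.

(** An ordinal is represented by a well-ordered type; two representatives
    denote the same ordinal when they are isomorphic ([oiso]), and the ordinals
    below [a] are the types of the initial segments [oseg x], [x : a]. *)
Structure ordinal_number := OrdinalNumber {
  osort :> Type;
  leo : rel osort;
  leo_wo : well_order leo }.

Arguments leo {o}.

Definition oiso (a b : ordinal_number) : Prop :=
  exists2 f : a -> b, bijective f & forall x y, leo (f x) (f y) = leo x y.

Section OrdinalOrder.
Variable a : ordinal_number.

Lemma leo_min (P : a -> Prop) :
  (exists x, P x) -> exists2 z, P z & forall y, P y -> leo z y.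
Proof.
case=> x Px.
have [|z [[Az lbz] _]] := @leo_wo a [pred x | `[< P x >]].
  by exists x; apply/asboolP.
exists z => [|y Py]; first exact/asboolP.
by apply: lbz; apply/asboolP.
Qed.

Lemma leo_refl (x : a) : leo x x.
Proof. by have [z -> zx] := @leo_min (eq x) (ex_intro _ x erefl); exact: zx. Qed.

Lemma leo_total (x y : a) : leo x y || leo y x.
Proof.
have [|z [] -> zP] := @leo_min (fun z => z = x \/ z = y).
- by exists x; left.
- by rewrite zP//; right.
- by rewrite orbC zP//; left.
Qed.

Lemma leo_anti (x y : a) : leo x y -> leo y x -> x = y.
Proof.
move=> xy yx.
have [|z [_ uz]] := @leo_wo a [pred z | `[< z = x \/ z = y >]].
  by exists x; apply/asboolP; left.
rewrite -(uz x) ?(uz y)//; split.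
- by apply/asboolP; right.
- by move=> t /asboolP[->|->]//; exact: leo_refl.
- by apply/asboolP; left.
- by move=> t /asboolP[->|->]//; exact: leo_refl.
Qed.

Lemma leo_trans (y x z : a) : leo x y -> leo y z -> leo x z.
Proof.
move=> xy yz.
have [|t] := @leo_min (fun t => [\/ t = x, t = y | t = z]).
  by exists x; constructor 1.
case=> -> tP; first by apply: tP; constructor 3.
- by rewrite (leo_anti xy) //; apply: tP; constructor 1.
- by rewrite -(leo_anti yz) //; apply: tP; constructor 2.
Qed.

End OrdinalOrder.

Lemma well_orderI (T : Type) (R : rel T) :
  (forall x y, R x y -> R y x -> x = y) ->
  (forall P : T -> Prop, (exists x, P x) ->
    exists2 z, P z & forall y, P y -> R z y) -> well_order R.
Proof.
move=> Ranti Rmin; apply: antisymmetric_well_order => [x y /andP[]|A [x Ax]].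
  exact: Ranti.
by have [|z Az zA] := Rmin (fun x => x \in A); [exists x|exists z].
Qed.

Lemma oseg_subproof (a : ordinal_number) (x : a) :
  @well_order {y : a | ~~ leo x y} (fun y z => leo (sval y) (sval z)).
Proof.
apply: well_orderI => [y z yz zy|P [y Py]].
  by apply: val_inj; exact: leo_anti.
have [|z [w wz Pw] zP] :=
  @leo_min a (fun z => exists2 w : {y : a | ~~ leo x y}, sval w = z & P w).
  by exists (sval y), y.
by exists w => // t Pt; rewrite wz; apply: zP; exists t.
Qed.

Definition oseg (a : ordinal_number) (x : a) : ordinal_number :=
  OrdinalNumber (@oseg_subproof a x).

Definition olt (a b : ordinal_number) : Prop := exists x : b, oiso a (oseg x).

Definition ole (a b : ordinal_number) : Prop := olt a b \/ oiso a b.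

Lemma oiso_sym (a b : ordinal_number) : oiso a b -> oiso b a.
Proof.
case=> f [g fK gK] fle; exists g; first by exists f.
by move=> x y; rewrite -fle !gK.
Qed.

Lemma oiso_refl (a : ordinal_number) : oiso a a.
Proof. by exists id => //; exists id. Qed.

Lemma oiso_trans (b a c : ordinal_number) : oiso a b -> oiso b c -> oiso a c.
Proof.
move=> [f fb fle] [g gb gle]; exists (g \o f); first exact: bij_comp.
by move=> x y /=; rewrite gle fle.
Qed.

Lemma oiso_seg (a b : ordinal_number) (f : a -> b) :
  bijective f -> (forall x y, leo (f x) (f y) = leo x y) ->
  forall x, oiso (oseg x) (oseg (f x)).
Proof.
move=> [g fK gK] fle x.
have p1 (y : oseg x) : ~~ leo (f x) (f (sval y)).
  by rewrite fle; exact: (svalP y).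
have p2 (y : oseg (f x)) : ~~ leo x (g (sval y)).
  by rewrite -fle gK; exact: (svalP y).
pose F (y : oseg x) : oseg (f x) := exist _ (f (sval y)) (p1 y).
pose G (y : oseg (f x)) : oseg x := exist _ (g (sval y)) (p2 y).
exists F => [|y z]; last exact: fle.
by exists G => y; apply: val_inj; [exact: fK|exact: gK].
Qed.

Lemma oseg_oseg (a : ordinal_number) (x : a) (y : oseg x) :
  oiso (oseg y) (oseg (sval y)).
Proof.
have p1 (z : oseg y) : ~~ leo (sval y) (sval (sval z)) by exact: (svalP z).
have p2 (z : oseg (sval y)) : ~~ leo x (sval z).
  apply/negP => xz; have := svalP z; have := svalP y; move/negP => /=.
  have /orP[yz|zy] := leo_total (sval y) (sval z); first by rewrite yz.
  by move=> nxy; case: nxy; exact: leo_trans zy.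
pose F (z : oseg y) : oseg (sval y) := exist _ (sval (sval z)) (p1 z).
pose G (z : oseg (sval y)) : oseg y :=
  exist _ (exist _ (sval z) (p2 z) : oseg x) (svalP z).
exists F => //; exists G => z; last exact: val_inj.
by do 2!apply: val_inj.
Qed.

Lemma olt_wf : well_founded olt.
Proof.
have segAcc (a : ordinal_number) (x : a) : forall b, oiso b (oseg x) -> Acc olt b.
  apply: contrapT => nacc.
  have [|z Pz zP] := @leo_min a
    (fun z => ~ forall b, oiso b (oseg z) -> Acc olt b).
    by exists x.
  apply: Pz => b bz; constructor => c [y cy].
  have [f fb fle] := bz.
  pose t := sval (f y).
  have ct : oiso c (oseg t).
    by apply: oiso_trans (oseg_oseg _); apply: oiso_trans cy _; exact: oiso_seg.
  apply: contrapT => nc; have : leo z t by apply: zP => /(_ _ ct).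
  exact/negP/(svalP (f y)).
by move=> a; constructor => b [x]; exact: segAcc.
Qed.

Lemma oiso_lt (a b c : ordinal_number) : oiso a b -> olt b c -> olt a c.
Proof. by move=> ab [x bx]; exists x; exact: oiso_trans bx. Qed.

Lemma olt_iso (b a c : ordinal_number) : olt a b -> oiso b c -> olt a c.
Proof.
move=> [x ax] [f fb fle]; exists (f x).
exact: oiso_trans ax (oiso_seg fb fle x).
Qed.

Lemma olt_irr (a : ordinal_number) : ~ olt a a.
Proof.
by elim/(well_founded_ind olt_wf): a => a IH aa; exact: (IH _ aa aa).
Qed.

Lemma oseg_lt (a : ordinal_number) (x y : a) :
  ~~ leo y x -> olt (oseg x) (oseg y).
Proof.
move=> yx; exists (exist _ x yx : oseg y).
exact: oiso_sym (@oseg_oseg a y (exist _ x yx)).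
Qed.

Lemma oseg_inj (a : ordinal_number) (x y : a) : oiso (oseg x) (oseg y) -> x = y.
Proof.
move=> xy; apply: leo_anti; apply: contrapT => /negP /oseg_lt lt.
  by case: (@olt_irr (oseg x)); exact: oiso_lt xy lt.
by case: (@olt_irr (oseg x)); exact: olt_iso lt (oiso_sym xy).
Qed.

Lemma olt_trichotomy (a b : ordinal_number) : [\/ olt a b, oiso a b | olt b a].
Proof.
elim/(well_founded_ind olt_wf): a => a IH.
have [[x bx]|nb] := pselect (exists x : a, ole b (oseg x)).
  constructor 3; case: bx => [[t bt]|bx]; last by exists x.
  by exists (sval t); exact: oiso_trans bt (oseg_oseg t).
have /choice[f fP] (x : a) : exists y : b, oiso (oseg x) (oseg y).
  have xa : olt (oseg x) a by exists x; exact: oiso_refl.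
  case: (IH _ xa) => [//|xb|bx]; case: nb; exists x; last by left.
  by right; exact: oiso_sym.
have flt x y : ~~ leo y x -> ~~ leo (f y) (f x).
  move=> /oseg_lt /olt_iso /(_ (fP y)) [t xt].
  suff -> : f x = sval t by exact: svalP t.
  apply: oseg_inj; apply: oiso_trans (oiso_sym (fP x)) _.
  exact: oiso_trans xt (oseg_oseg t).
have fle x y : leo (f x) (f y) = leo x y.
  have [xy|/flt/negbTE//] := boolP (leo x y).
  have [-> |yx] := pselect (x = y); first exact: leo_refl.
  have : ~~ leo y x by apply/negP => /(leo_anti xy).
  by move=> /flt nle; have /orP[//|le] := leo_total (f x) (f y);
    rewrite le in nle.
have finj x y : f x = f y -> x = y.
  by move=> xy; apply: leo_anti; rewrite -fle xy leo_refl.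
have fdown x y : ~~ leo (f x) y -> exists x', f x' = y.
  move=> /oseg_lt /olt_iso /(_ (oiso_sym (fP x))) [t yt].
  exists (sval t); apply: oseg_inj; apply: oiso_trans (oiso_sym (fP _)) _.
  exact: oiso_trans (oiso_sym (oseg_oseg t)) (oiso_sym yt).
have [fsurj|/existsNP[y0 y0P]] := pselect (forall y, exists x, f x = y).
  constructor 2; have [g gP] := choice fsurj; exists f => //.
  by exists g => // x; apply: finj.
have [|z nz zP] := @leo_min b (fun y => ~ exists x, f x = y); first by exists y0.
have fz x : ~~ leo z (f x).
  apply/negP => zf; apply: nz.
  have [-> |zfx] := pselect (z = f x); first by exists x.
  by apply: (fdown x); apply/negP => fzx; apply: zfx; exact: leo_anti.
pose F (x : a) : oseg z := exist _ (f x) (fz x).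
have /choice[G GP] (y : oseg z) : exists x, F x = y.
  have [x xy] : exists x, f x = sval y.
    by apply: contrapT => /zP; apply/negP; exact: svalP y.
  by exists x; exact: val_inj.
constructor 1; exists z; exists F => //.
exists G => // x; apply: finj.
by have /(congr1 sval) := GP (F x).
Qed.

Lemma ozero_subproof : @well_order void (fun _ _ => true).
Proof. by move=> A [[]]. Qed.

Definition ozero : ordinal_number := OrdinalNumber ozero_subproof.

Lemma osucc_subproof (a : ordinal_number) :
  @well_order (option a) (fun x y =>
    if y is Some y' then if x is Some x' then leo x' y' else false else true).
Proof.
apply: well_orderI => [[x|] [y|] //|P [x Px]].
  by move=> xy yx; rewrite (leo_anti xy yx).
have [[y Py]|nP] := pselect (exists y, P (Some y)).
  have [|z Pz zP] := @leo_min a (P \o Some); first by exists y.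
  by exists (Some z) => // -[t|//] /zP.
exists None; last by case=> // y Py; case: nP; exists y.
by case: x Px => // y Py; case: nP; exists y.
Qed.

Definition osucc (a : ordinal_number) : ordinal_number :=
  OrdinalNumber (@osucc_subproof a).

Lemma omega_subproof : well_order leq.
Proof.
apply: well_orderI => [x y xy yx|P [x Px]].
  by apply/eqP; rewrite eqn_leq xy.
have exP : exists n, `[< P n >] by exists x; apply/asboolP.
case: (ex_minnP exP) => m /asboolP Pm mP.
by exists m => // y Py; apply: mP; apply/asboolP.
Qed.

Definition omega : ordinal_number := OrdinalNumber omega_subproof.

Definition oaddn (a : ordinal_number) (n : nat) : ordinal_number := iter n osucc a.

(** With this convention [0] is a limit ordinal. *)
Definition limit_ordinal (a : ordinal_number) : Prop :=
  ~ exists b, oiso a (osucc b).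

Definition is_least (P : ordinal_number -> Prop) (a : ordinal_number) : Prop :=
  P a /\ forall b, P b -> ole a b.

(** By [oleastP] below, the default [ozero] is used only when no ordinal
    satisfies [P]. *)
Definition oleast (P : ordinal_number -> Prop) : ordinal_number :=
  if pselect (exists a, is_least P a) is left h then sval (cid h) else ozero.

Lemma oleastP (P : ordinal_number -> Prop) :
  (exists a, P a) -> is_least P (oleast P).
Proof.
move=> [a Pa].
suff h : exists a, is_least P a.
  by rewrite /oleast; case: pselect => // h'; exact: (svalP (cid h')).
elim/(well_founded_ind olt_wf): a Pa => a IH Pa.
have [[b [ba Pb]]|nb] := pselect (exists b, olt b a /\ P b); first exact: IH Pb.
exists a; split=> // b Pb.
case: (olt_trichotomy a b) => [ab|ab|ba]; [by left|by right|].
by case: nb; exists b.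
Qed.

Definition ocard (T : Type) : ordinal_number :=
  oleast (fun a => [set: T] #= [set: a]).

(** Cardinals are initial ordinals, so the successor cardinal of [k] is the
    least ordinal whose cardinality is strictly larger than that of [k]. *)
Definition csucc (k : ordinal_number) : ordinal_number :=
  oleast (fun a => [set: k] #<= [set: a] /\ ~ ([set: a] #<= [set: k])).

(** The singleton of the greatest element is cofinal in a successor ordinal, and
    [set0] is cofinal in [ozero], so that [cf] takes the values [1] and [0]
    there. *)
Definition cofinal (a : ordinal_number) (A : set a) : Prop :=
  forall x : a, exists2 y, A y & leo x y.

Definition cf (a : ordinal_number) : ordinal_number :=
  oleast (fun k => exists2 A : set a, cofinal A & A #= [set: k]).

(** The limit part of [a] is unique, so that [oleast] merely names it. *)
Definition olim (a : ordinal_number) : ordinal_number :=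
  oleast (fun m => limit_ordinal m /\ exists n : nat, oiso a (oaddn m n)).

Definition baire : topologicalType := prod_topology (fun _ : nat => nat).

Definition le_star (f g : baire) : Prop := \forall n \near \oo, (f n <= g n)%N.

Definition dominating (D : set baire) : Prop :=
  forall f, exists2 g, D g & le_star f g.

Definition dnum : ordinal_number :=
  oleast (fun k => exists2 D : set baire, dominating D & D #= [set: k]).

Definition continuum : ordinal_number := ocard (set nat).

Definition K_Lusin (L : set baire) : Prop :=
  forall K : set baire, compact K -> countable (K `&` L).

Section Scattered.
Variable X : topologicalType.

Definition first_countable : Prop :=
  forall x : X, exists2 B : set (set X), countable B &
    B `<=` nbhs x /\ forall U, nbhs x U -> exists2 V, B V & V `<=` U.

Definition lindelof : Prop :=
  forall C : set (set X), C `<=` open -> \bigcup_(U in C) U = setT ->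
    exists D : set (set X),
      [/\ D `<=` C, countable D & \bigcup_(U in D) U = setT].

Definition scattered : Prop :=
  forall A : set X, A !=set0 -> isolated A !=set0.

Definition derived (A : set X) : set X := A `\` isolated A.

(** [X^(a)] is the intersection over [b < a] of the sets of non-isolated points
    of [X^(b)]; see [cb_derivE]. *)
Definition cb_deriv : ordinal_number -> set X :=
  Fix olt_wf (fun _ => set X) (fun a rec =>
    [set x | forall b (ba : olt b a), derived (rec b ba) x]).

Lemma cb_derivE (a : ordinal_number) :
  cb_deriv a = [set x | forall b, olt b a -> derived (cb_deriv b) x].
Proof.
rewrite /cb_deriv Fix_eq// => b f g fg.
by congr mkset; apply/funext => x; apply/propext; split=> H c cb;
  move: (H c cb); rewrite fg.
Qed.

Definition scattered_height : ordinal_number :=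
  oleast (fun a => cb_deriv a = set0).

Definition FLS : Prop :=
  [/\ hausdorff_space X, first_countable, lindelof & scattered].

End Scattered.

(* Main.v *)
Require Import Defs.
From HB Require Import structures.
From mathcomp Require Import all_boot all_order all_algebra.
From mathcomp Require Import wochoice all_classical topology.

Set Implicit Arguments.
Unset Strict Implicit.
Unset Printing Implicit Defensive.

Local Open Scope classical_set_scope.
Local Open Scope card_scope.

(** From a space to its height.  Let [X] be an uncountable FLS space of height
    [a].  Since the derivatives [X^(b)] are closed and decrease, a Lindelof set
    that misses [X^(m)], for [m] a limit of uncountable cofinality, misses some
    [X^(b)] with [b < m] ([lindelof_deriv_empty]); with [m = a] this gives
    [cf a <= omega].  If [a = m + n] with [n > 0] and the cofinality of [m]
    exceeded the dominating number, then the same would hold modulo [X^(m)]: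
    the top level of [X] is a countable closed discrete set [T]; a choice of
    basic neighbourhoods of its points is a function [g : nat -> nat], and the
    complement [F_g] of their union has one level less.  The sets [F_g], for [g]
    in a dominating family, cover everything outside [T], and each contributes
    one bound below [m], so some bound serves them all ([closed_rank_bound]),
    against scatteredness.  Finally [a] has at most continuum many elements
    because [X] has at most continuum many points; this is Arhangelskii's
    theorem, in the closing-off form ([card_FLS]).

    From an ordinal to a space.  All spaces are obtained by one construction.
    Points of an index set [Y] carry a code in the Cantor space and a rank in
    [nat]; a neighbourhood of a point contains all points of smaller rank with
    nearby code; and each point of rank [0] is replaced by a whole FLS space.
    The result is Hausdorff, first countable and scattered, and it is Lindelof
    under a condition on codes and ranks alone ([layered_FLS]).  Its height is
    at least the heights of the inserted spaces; if these are at most [b], it is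
    at most [b + n] when the ranks are at most [n], and at most [b + omega] in
    general.  Index sets of three kinds are used:
    - countable ones, which give sums, hence countable suprema of heights, and
      one-point limits of sequences of copies, which give successors;
    - the Cantor space itself, cut into layers of all finite ranks that meet
      every uncountable closed set (a Bernstein decomposition).  If the heights
      of FLS spaces below a limit [a] are bounded in [a], inserting one space of
      each such height produces a height that is at most [a] and cannot be
      smaller, as its successor would be one of the inserted heights
      ([is_FLS_height_bounded]);
    - the tree of finite sequences, of rank [1], together with a K-Lusin set [L]
      of branches, of rank [0].  The Lindelof condition is that a finitely
      branching tree has only countably many branches in [L], which holds since
      its branches are bounded by one function and thus lie in a compact set.
      Inserting spaces of heights cofinal in a limit [m] of uncountable
      cofinality at most the dominating number gives the height [m] or [m + 1],
      and [m] is excluded by the first part ([is_FLS_height_succ_limit]).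
    With one-point spaces inserted, the last index set is an uncountable FLS
    space of height [2]; adding it as a summand makes any space of height at
    least [2] uncountable without changing the height. *)

Local Arguments cb_deriv : clear implicits.

(** * Ordinals, cofinality and cardinals *)

Lemma olt_trans (b a c : ordinal_number) : olt a b -> olt b c -> olt a c.
Proof.
move=> [x ax] /[dup] [[y [f fb fle]] _]; exists (sval (f x)).
apply: oiso_trans ax (oiso_trans (oiso_seg fb fle x) _).
exact: oseg_oseg.
Qed.

Lemma ole_refl (a : ordinal_number) : ole a a.
Proof. by right; exact: oiso_refl. Qed.

Lemma olt_ole_trans (b a c : ordinal_number) : olt a b -> ole b c -> olt a c.
Proof. by move=> ab [|/(olt_iso ab)//]; exact: olt_trans. Qed.

Lemma ole_lt_trans (b a c : ordinal_number) : ole a b -> olt b c -> olt a c.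
Proof. by move=> [/olt_trans|/oiso_lt]; apply. Qed.

Lemma ole_trans (b a c : ordinal_number) : ole a b -> ole b c -> ole a c.
Proof.
move=> ab [bc|bc]; first by left; exact: ole_lt_trans bc.
by case: ab => ab; [left; exact: olt_iso bc|right; exact: oiso_trans bc].
Qed.

Lemma oleNgt (a b : ordinal_number) : ole a b <-> ~ olt b a.
Proof.
split=> [ab ba|nba]; first exact: (olt_irr (olt_ole_trans ba ab)).
by case: (olt_trichotomy a b) => //; [left|right].
Qed.

Lemma oltNge (a b : ordinal_number) : olt a b <-> ~ ole b a.
Proof. by rewrite (propext (oleNgt b a)) notK. Qed.

Lemma ole_anti (a b : ordinal_number) : ole a b -> ole b a -> oiso a b.
Proof. by move=> [ab|//] /oleNgt/(_ ab). Qed.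

Lemma olt_seg (a : ordinal_number) (x : a) : olt (oseg x) a.
Proof. by exists x; exact: oiso_refl. Qed.

Lemma olt_osegE (a : ordinal_number) (x y : a) :
  olt (oseg x) (oseg y) <-> ~~ leo y x.
Proof.
split=> [xy|]; last exact: oseg_lt.
apply/negP => yx; have [yx'|/negP/oseg_lt] := pselect (leo x y).
  by move: xy; rewrite (leo_anti yx yx'); exact: olt_irr.
by move=> /(olt_trans xy); exact: olt_irr.
Qed.

Lemma oltP (a b : ordinal_number) : olt a b <-> exists x : b, oiso (oseg x) a.
Proof. by split=> -[x /oiso_sym]; exists x. Qed.

Lemma osucc_emb (a : ordinal_number) :
  exists f : a -> @oseg (osucc a) None, [/\ bijective f,
    forall x y, leo (f x) (f y) = leo x y & forall x, sval (f x) = Some x].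
Proof.
have p (x : a) : ~~ @leo (osucc a) None (Some x) by [].
exists (fun x => exist _ (Some x) (p x) : @oseg (osucc a) None); split=> //.
have /choice[g gP] (u : @oseg (osucc a) None) : exists x, sval u = Some x.
  by case: u => -[x|] // xN; exists x.
exists g => [x|u]; last by apply: val_inj => /=; rewrite -gP.
by have := gP (exist _ (Some x) (p x)) => -[].
Qed.

Lemma osucc_segN (a : ordinal_number) : oiso a (@oseg (osucc a) None).
Proof. by have [f [fb fle _]] := osucc_emb a; exists f. Qed.

Lemma osucc_segS (a : ordinal_number) (x : a) :
  oiso (oseg x) (@oseg (osucc a) (Some x)).
Proof.
have [f [fb fle fE]] := osucc_emb a; rewrite -fE.
exact: oiso_trans (oiso_seg fb fle x) (oseg_oseg _).
Qed.

Lemma olt_succE (a b : ordinal_number) : olt b (osucc a) <-> ole b a.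
Proof.
split.
  move=> [[x bx|/oiso_trans bN]].
    by left; exists x; exact: oiso_trans bx (oiso_sym (osucc_segS x)).
  by right; apply: bN; exact: oiso_sym (osucc_segN a).
case=> [[x bx]|ba].
  by exists (Some x); exact: oiso_trans bx (osucc_segS x).
by exists None; exact: oiso_trans ba (osucc_segN a).
Qed.

Lemma osucc_leE (a b : ordinal_number) : ole (osucc a) b <-> olt a b.
Proof.
rewrite (propext (oleNgt _ _)) (propext (olt_succE _ _)).
by rewrite -(propext (oltNge _ _)).
Qed.

Lemma olt_succ (a : ordinal_number) : olt a (osucc a).
Proof. by apply/olt_succE; exact: ole_refl. Qed.

Lemma osucc_iso (a b : ordinal_number) : oiso a b -> oiso (osucc a) (osucc b).
Proof.
move=> ab; apply: ole_anti; apply/osucc_leE/olt_succE; right=> //.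
exact: oiso_sym.
Qed.

Lemma limit_succ_lt (a b : ordinal_number) :
  limit_ordinal a -> olt b a -> olt (osucc b) a.
Proof.
move=> lima /osucc_leE [//|bsa]; case: lima; exists b; exact: oiso_sym.
Qed.

Lemma limit_part (a : ordinal_number) :
  exists m, limit_ordinal m /\ exists n, oiso a (oaddn m n).
Proof.
elim/(well_founded_ind olt_wf): a => a IH.
have [lima|/contrapT[b ab]] := pselect (limit_ordinal a).
  by exists a; split => //; exists 0; exact: oiso_refl.
have [|m [limm [n bn]]] := IH b.
  exact: olt_iso (olt_succ b) (oiso_sym ab).
exists m; split=> //; exists n.+1.
exact: oiso_trans ab (osucc_iso bn).
Qed.

Lemma olimP (a : ordinal_number) :
  limit_ordinal (olim a) /\ exists n, oiso a (oaddn (olim a) n).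
Proof. exact: (oleastP (limit_part a)).1. Qed.

Lemma ole_oaddn (a : ordinal_number) n : ole a (oaddn a n).
Proof.
elim: n => [|n IH]; first exact: ole_refl.
by left; apply/olt_succE.
Qed.

Lemma sval_inj (T : Type) (P : T -> Prop) : injective (@sval T P).
Proof.
move=> [x Px] [y Py] /= xy; subst y.
by have -> : Px = Py by exact: Prop_irrelevance.
Qed.

Lemma inj_card_leT (T U : Type) (f : T -> U) :
  injective f -> [set: T] #<= [set: U].
Proof.
move=> finj; have := @inj_card_eq _ _ setT f (in2W finj).
by rewrite card_eq_le => /andP[_ /card_le_trans]; apply; exact: card_leT.
Qed.

Lemma card_sig (T : Type) (A : set T) : [set: {x | A x}] #= A.
Proof.
have E : (fun x : {x | A x} => sval x) @` setT = A.
  apply/seteqP; split=> [_ [x _ <-]|x Ax]; first exact: svalP.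
  by exists (exist _ x Ax).
apply: card_eq_trans (card_esym (inj_card_eq (in2W (@sval_inj _ _)))) _.
by rewrite E; exact: card_eqxx.
Qed.

Lemma card_leT_inj (T U : Type) :
  [set: T] #<= [set: U] -> exists f : T -> U, injective f.
Proof.
elim/Ppointed: U => U; last first.
  by move=> /pcard_injP[f finj]; exists f => x y; apply: finj; rewrite inE.
rewrite card_le_emptyr => /eqP T0.
have noT (t : T) : False by have : [set: T] t by []; rewrite T0.
by exists (fun t => False_rect U (noT t)) => t; case: (noT t).
Qed.

Lemma card_leT_surj (T U : Type) (t0 : T) :
  [set: T] #<= [set: U] -> exists g : U -> T, forall t, exists u, g u = t.
Proof.
move=> /card_leT_inj[f finj].
have /choice[g gP] (u : U) : exists t, (exists t', f t' = u) -> f t = u.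
  by have [[t ft]|nt] := pselect (exists t', f t' = u); [exists t|exists t0].
by exists g => t; exists (f t); apply: finj; apply: gP; exists t.
Qed.

Lemma countableU (T : Type) (A B : set T) :
  countable A -> countable B -> countable (A `|` B).
Proof.
move=> cA cB; have -> : A `|` B = \bigcup_(b in [set: bool]) if b then A else B.
  apply/seteqP; split=> [x [Ax|Bx]|x [[] _ ?]].
  - by exists true.
  - by exists false.
  - by left.
  - by right.
by apply: bigcup_countable => [|[] _].
Qed.

Lemma ole_card (a b : ordinal_number) : ole a b -> [set: a] #<= [set: b].
Proof.
move=> ab; suff [f finj] : exists f : a -> b, injective f.
  exact: inj_card_leT finj.
case: ab => [[x [f /bij_inj finj _]]|[f /bij_inj finj _]]; last by exists f.
by exists (sval \o f) => y z /val_inj; exact: finj.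
Qed.

Section Suborder.
Variables (a : ordinal_number) (P : a -> Prop).

Lemma osub_subproof :
  @well_order {y : a | P y} (fun y z => leo (sval y) (sval z)).
Proof.
apply: well_orderI => [y z yz zy|Q [y Qy]].
  by apply: sval_inj; exact: leo_anti.
have [|z [w wz Qw] zP] :=
  @leo_min a (fun z => exists2 w : {y : a | P y}, sval w = z & Q w).
  by exists (sval y), y.
by exists w => // t Qt; rewrite wz; apply: zP; exists t.
Qed.

Definition osub : ordinal_number := OrdinalNumber osub_subproof.

(** A strictly increasing self-map of a well-order never moves a point down, so
    the whole order cannot embed below one of its own elements. *)
Lemma osub_le : ole osub a.
Proof.
apply/oleNgt => -[x [f _ fle]].
pose g y : a := sval (sval (f y)).
have gle y z : leo (g y) (g z) = leo y z by exact: fle.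
have gx y : ~~ leo (sval x) (g y) by exact: (svalP (f y)).
suff /(_ (sval x)) : forall y, leo y (g y) by apply/negP.
apply: contrapT => /existsNP bad.
have [z nz zP] := leo_min bad.
by apply: (nz); apply: zP; rewrite gle.
Qed.

End Suborder.

Lemma cf_cofinal (a : ordinal_number) :
  exists2 A : set a, cofinal A & A #= [set: cf a].
Proof.
have [|//] := @oleastP (fun k => exists2 A : set a, cofinal A & A #= [set: k]).
exists a, setT; last exact: card_eqxx.
by move=> x; exists x => //; exact: leo_refl.
Qed.

Lemma cf_le (a k : ordinal_number) (A : set a) :
  cofinal A -> A #<= [set: k] -> ole (cf a) k.
Proof.
move=> cofA /card_subP[C CA _].
apply: ole_trans (osub_le C).
suff AC : exists2 A' : set a, cofinal A' & A' #= [set: osub C].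
  by apply: (oleastP _).2 => //; exists (osub C).
exists A => //; rewrite -(card_eql CA).
exact: card_esym (card_sig C).
Qed.

Lemma cf_iso_le (a b k : ordinal_number) :
  oiso a b -> ole (cf a) k -> ole (cf b) k.
Proof.
move=> [f [g fK gK] fle] ak; have [A cofA Aa] := cf_cofinal a.
apply: (@cf_le _ _ (f @` A)) => [y|].
  by have [x Ax yx] := cofA (g y); exists (f x); [exists x|rewrite -(gK y) fle].
apply: card_le_trans (card_image_le _ _) _; rewrite (card_le_eql Aa).
exact: ole_card.
Qed.

(** The contrapositive of [cf_le]: a set without strict upper bound is cofinal. *)
Lemma cf_bounded (a k : ordinal_number) (A : set a) :
  ~ ole (cf a) k -> A #<= [set: k] -> exists b, forall x, A x -> ~~ leo b x.
Proof.
move=> ncf Ak; apply: contrapT => nb; apply: ncf; apply: cf_le Ak => b.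
apply: contrapT => nA; apply: nb; exists b => x Ax.
by apply/negP => bx; apply: nA; exists x.
Qed.

Lemma ordinal_of_type (T : Type) :
  exists a : ordinal_number, [set: T] #= [set: a].
Proof.
have [R Rwo] := well_ordering_principle {classic T}.
by exists (OrdinalNumber Rwo); exact: card_eqxx.
Qed.

Lemma Cantor (T : Type) : ~ ([set: set T] #<= [set: T]).
Proof.
move=> /card_leT_inj[f finj].
pose D := [set t | exists2 A, f A = t & ~ A t].
have [Df|nDf] := pselect (D (f D)); last by apply: (nDf); exists D.
by case: (Df) => A /finj ->.
Qed.

Lemma continuum_card : [set: set nat] #= [set: continuum].
Proof. exact: (oleastP (ordinal_of_type _)).1. Qed.

Lemma olt_csuccP (a : ordinal_number) :
  olt a (csucc continuum) <-> [set: a] #<= [set: set nat].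
Proof.
rewrite (card_le_eqr continuum_card).
have [|[cs ncs] csP] := @oleastP
    (fun a => [set: continuum] #<= [set: a] /\
      ~ ([set: a] #<= [set: continuum])).
  have [b bP] := ordinal_of_type (set (set nat)); exists b.
  rewrite -(card_le_eql continuum_card) -(card_le_eqr continuum_card).
  rewrite -(card_le_eqr bP) -(card_le_eql bP); split; last exact: Cantor.
  apply: (@inj_card_leT _ _ (fun A => [set A])) => A B.
  by move=> /seteqP[/(_ A)] /(_ erefl).
split=> [acs|ac].
  case: (olt_trichotomy a continuum) => [ac|ac|ca]; last first.
  - apply: contrapT => nac; apply/(iffLR (oleNgt _ _) _ acs).
    by apply: csP; split=> //; apply: ole_card; left.
  - by apply: ole_card; right.
  - by apply: ole_card; left.
apply/oltNge => csa; apply: ncs.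
exact: card_le_trans (ole_card csa) ac.
Qed.

Lemma cf_succ_le (a : ordinal_number) : ole (cf (osucc a)) omega.
Proof.
apply: (@cf_le (osucc a) omega [set None]); last exact: countable1.
by move=> x; exists None => //; case: x.
Qed.

(** * Cantor-Bendixson derivatives *)

Section Derivatives.
Variable X : topologicalType.
Implicit Types (A F V : set X) (x : X) (a b : ordinal_number).

Lemma isolatedP A x :
  isolated A x <-> A x /\ exists V, [/\ open V, V x & V `&` A `<=` [set x]].
Proof.
split=> [[/set_mem Ax [V]]|[Ax [V [oV Vx VA]]]].
  rewrite nbhsE => -[W [oW Wx] WV] VA; split=> //; exists W; split=> //.
  by rewrite -VA; exact: setSI.
split; first exact/mem_set.
exists V; first exact: open_nbhs_nbhs.
by apply/seteqP; split=> // _ ->.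
Qed.

(** The non-isolated points of [A] are those of [A] that lie in no open set
    meeting [A] in at most one point. *)
Lemma closed_derived A : closed A -> closed (derived A).
Proof.
move=> cA; have -> : derived A = A `&`
    ~` \bigcup_(V in [set V | open V /\ exists x, V `&` A `<=` [set x]]) V.
  apply/seteqP; split=> x [Ax nx]; split=> //.
    move=> [V [oV [y Vy]] Vx]; apply: nx; apply/isolatedP; split=> //.
    by exists V; split=> // z /[dup] /Vy -> _; rewrite (Vy x).
  by move=> /isolatedP[_ [V [oV Vx VA]]]; apply: nx; exists V => //; split=> //;
    exists x.
apply: closedI => //; apply: open_closedC; apply: bigcup_open => V [oV _].
exact: oV.
Qed.

Lemma cb_derivS a b : ole a b -> cb_deriv X b `<=` cb_deriv X a.
Proof.
move=> ab x; rewrite [cb_deriv X b]cb_derivE [cb_deriv X a]cb_derivE => Hx c ca.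
by apply: Hx; exact: olt_ole_trans ab.
Qed.

Lemma cb_deriv_iso a b : oiso a b -> cb_deriv X a = cb_deriv X b.
Proof.
move=> ab; apply/seteqP; split; apply: cb_derivS; right => //.
exact: oiso_sym.
Qed.

Lemma cb_deriv_lt a b : olt a b -> cb_deriv X b `<=` derived (cb_deriv X a).
Proof. by move=> ab x; rewrite cb_derivE; exact. Qed.

Lemma cb_deriv_succ a : cb_deriv X (osucc a) = derived (cb_deriv X a).
Proof.
apply/seteqP; split; first exact/cb_deriv_lt/olt_succ.
move=> x Dx; rewrite cb_derivE => b /olt_succE[ba|/cb_deriv_iso ->//].
by apply: (cb_deriv_lt ba); case: Dx.
Qed.

Lemma cb_deriv0 : cb_deriv X ozero = setT.
Proof. by apply/seteqP; split=> // x _; rewrite cb_derivE => b [[]]. Qed.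

Lemma closed_cb_deriv a : closed (cb_deriv X a).
Proof.
elim/(well_founded_ind olt_wf): a => a IH.
have -> : cb_deriv X a = \bigcap_(x in [set: a]) derived (cb_deriv X (oseg x)).
  apply/seteqP; split=> x; rewrite cb_derivE.
    by move=> Hx y _; apply: Hx; exact: olt_seg.
  by move=> Hx b /oltP[y /cb_deriv_iso <-]; exact: Hx.
by apply: closed_bigI => x _; apply: closed_derived; apply: IH; exact: olt_seg.
Qed.

Lemma scattered_cb_deriv_lt a b : scattered X -> cb_deriv X a !=set0 ->
  olt a b -> ~ cb_deriv X a `<=` cb_deriv X b.
Proof.
move=> scX /scX[x xi] ab sub; have := cb_deriv_lt ab (sub _ (isolatedS xi)).
by case.
Qed.

(** Isolated points of distinct derivatives are distinct, so nonempty
    derivatives cannot outnumber the points. *)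
Lemma card_nonempty_derivatives a : scattered X ->
  (forall x : a, cb_deriv X (oseg x) !=set0) -> [set: a] #<= [set: X].
Proof.
move=> scX ne.
have /choice[f fP] (x : a) : exists p, isolated (cb_deriv X (oseg x)) p.
  exact/scX/ne.
apply: (@inj_card_leT _ _ f).
suff main (x y : a) : ~~ leo y x -> f x <> f y.
  move=> x y fxy; apply: leo_anti; apply: contrapT => /negP/main.
    by rewrite fxy.
  by rewrite fxy.
move=> /oseg_lt xy fxy; have := fP y; rewrite -fxy => /isolatedS.
by move=> /(cb_deriv_lt xy)[_]; apply; exact: fP.
Qed.

Definition is_height a := is_least (fun b => cb_deriv X b = set0) a.

Lemma scattered_heightP : scattered X -> is_height (scattered_height X).
Proof.
move=> scX; apply: oleastP; apply: contrapT => /forallNP ne.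
have [a aX] := ordinal_of_type (set X).
apply: (@Cantor X); rewrite (card_le_eql aX).
by apply: card_nonempty_derivatives => // x; apply/set0P/eqP.
Qed.

Lemma is_height_iso a b : oiso a b -> is_height a -> is_height b.
Proof.
move=> ab [a0 aP]; split=> [|c /aP ac]; first by rewrite -(cb_deriv_iso ab).
by apply: ole_trans ac; right; exact: oiso_sym.
Qed.

Lemma is_height_unique a b : is_height a -> is_height b -> oiso a b.
Proof. by move=> [a0 aP] [b0 bP]; apply: ole_anti; [exact: aP|exact: bP]. Qed.

Lemma is_height_lt a b : is_height a -> olt b a -> cb_deriv X b !=set0.
Proof. by move=> [_ aP] ba; apply/set0P/eqP => /aP /oleNgt. Qed.

(** A discrete closed set is covered by open sets meeting it in at most one
    point each; countably many of these suffice. *)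
Lemma closed_discrete_countable F : lindelof X -> closed F ->
  F `<=` isolated F -> countable F.
Proof.
move=> lX cF iF.
have [||D [DC cD DT]] := lX [set V | open V /\ exists x, V `&` F `<=` [set x]].
- by move=> V [].
- apply/seteqP; split=> // x _; have [Fx|nFx] := pselect (F x).
    have /isolatedP[_ [V [oV Vx VF]]] := iF _ Fx.
    by exists V => //; split=> //; exists x.
  exists (~` F) => //; split; first exact: closed_openC.
  by exists x => y [].
have -> : F = \bigcup_(V in D) (V `&` F).
  by rewrite -setI_bigcupl DT setTI.
apply: bigcup_countable => // V /DC[_ [x Vx]].
exact: sub_countable (subset_card_le Vx) (countable1 x).
Qed.

(** The complements of the derivatives of index below [a] cover [F]; the indices
    occurring in a countable subcover are bounded below [a], and derivatives
    decrease. *)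
Lemma lindelof_deriv_empty F a : lindelof X -> closed F -> limit_ordinal a ->
  ~ ole (cf a) omega -> F `&` cb_deriv X a = set0 ->
  exists b : a, F `&` cb_deriv X (oseg b) = set0.
Proof.
move=> lX cF lima ncf Fa.
have [b0 _] : exists b0 : a, True.
  have [|b _] := @cf_bounded a omega set0 ncf; last by exists b.
  exact: countable0.
pose C := [set V : set X |
  V = ~` F \/ exists b : a, V = ~` cb_deriv X (oseg b)].
have [||D [DC cD DT]] := lX C.
- move=> V [->|[b ->]]; apply: closed_openC => //; exact: closed_cb_deriv.
- apply/seteqP; split=> // x _; have [Fx|nFx] := pselect (F x); last first.
    by exists (~` F) => //; left.
  have : ~ cb_deriv X a x by move=> ax; have : (F `&` cb_deriv X a) x by [];
    rewrite Fa.
  rewrite cb_derivE => /existsNP[c /not_implyP[ca ncx]].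
  have /oltP[b bc] := limit_succ_lt lima ca.
  exists (~` cb_deriv X (oseg b)); first by right; exists b.
  by rewrite (cb_deriv_iso bc) cb_deriv_succ.
have /choice[f fP] (V : set X) :
    exists b : a, C V -> V `&` F `<=` ~` cb_deriv X (oseg b).
  have [[->|[b ->]]|nCV] := pselect (C V).
  - by exists b0 => _ x [].
  - by exists b => _ x [].
  - by exists b0.
have [|b bP] := @cf_bounded a omega (f @` D) ncf.
  exact: card_le_trans (card_image_le _ _) cD.
exists b; apply/seteqP; split=> // x [Fx bx].
have : [set: X] x by []; rewrite -DT => -[V DV Vx].
apply: (fP V (DC _ DV) x) => //; apply: cb_derivS bx.
by left; apply: oseg_lt; apply: bP; exists V.
Qed.

End Derivatives.

(** A decreasing base, with the smallness of its members stated from some index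
    on, so that larger indices may be used. *)
Lemma countable_base (X : topologicalType) (x : X) :
  first_countable X ->
  exists U : nat -> set X,
  [/\ forall n, open (U n), forall n, U n x &
      forall V, nbhs x V -> exists N, forall n, (N <= n)%N -> U n `<=` V].
Proof.
move=> fcX; have [B cB [Bx BV]] := fcX x.
have [V0 BV0 _] := BV setT filterT.
have /pfcard_geP[B0|/surjfunPex[f Bf]] := cB; first by rewrite B0 in BV0.
pose fix U n := if n is m.+1 then U m `&` (f m)° else setT.
have Uf n m : (m < n)%N -> U n `<=` (f m)°.
  elim: n => // n IH; rewrite ltnS leq_eqVlt => /orP[/eqP->|/IH sub] y [] //.
  by move=> /sub.
exists U; split=> [|n|V /BV[W + WV]].
- by elim=> [|n IH] /=; [exact: openT|apply: openI => //; exact: open_interior].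
- elim: n => //= n IH; split=> //; apply: Bx; rewrite Bf.
  by exists n.
- rewrite Bf => -[m _ fm]; exists m.+1 => n mn.
  apply: subset_trans (Uf _ _ mn) _; rewrite fm.
  exact: subset_trans (@interior_subset _ _) WV.
Qed.

Section FLSSpaces.
Variable X : topologicalType.
Hypothesis flsX : FLS X.

Let lX : lindelof X. Proof. by case: flsX. Qed.
Let scX : scattered X. Proof. by case: flsX. Qed.

(** A Lindelof space without a second level is discrete, hence countable. *)
Lemma uncountable_height_ge2 a : is_height X a -> ~ countable [set: X] ->
  ole (oaddn ozero 2) a.
Proof.
move=> [a0 _] ncX; apply/oleNgt => /olt_succE /cb_derivS sub.
apply: ncX; apply: closed_discrete_countable => // x _; apply: contrapT => nx.
have /sub : cb_deriv X (oaddn ozero 1) x by rewrite cb_deriv_succ cb_deriv0.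
by rewrite a0.
Qed.

(** If the cofinality were uncountable, the whole Lindelof space would already
    miss a derivative of smaller index. *)
Lemma cf_height a : is_height X a -> ole (cf a) omega.
Proof.
move=> ha; have [lima|/contrapT[b ab]] := pselect (limit_ordinal a); last first.
  exact: cf_iso_le (oiso_sym ab) (cf_succ_le b).
apply: contrapT => ncf.
have [|b b0] := lindelof_deriv_empty lX (@closedT X) lima ncf.
  by rewrite setTI; case: ha.
have [x bx] := is_height_lt ha (olt_seg b).
by have : ([set: X] `&` cb_deriv X (oseg b)) x by []; rewrite b0.
Qed.

End FLSSpaces.

(** By diagonalization: the sum of the first [n] members of a sequence is
    eventually above each of them. *)
Lemma dominating_uncountable (D : set baire) : dominating D -> ~ countable D.
Proof.
move=> domD /pfcard_geP[D0|/surjfunPex[e De]].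
  by have [g] := domD (fun=> 0); rewrite D0.
have [g + [N _ Ng]] := domD (fun n => (\sum_(i < n.+1) e i n).+1).
rewrite De => -[m _ em].
have := Ng (maxn N m) (leq_maxl _ _) => /=; rewrite -em.
have mlt : (m < (maxn N m).+1)%N by rewrite ltnS leq_maxr.
by rewrite (bigD1 (Ordinal mlt))//= ltnNge leq_addr.
Qed.

Lemma dnumP : exists2 D : set baire, dominating D & D #= [set: dnum].
Proof.
have [|//] := @oleastP
  (fun k => exists2 D : set baire, dominating D & D #= [set: k]).
have [a aP] := ordinal_of_type baire.
exists a, setT => // f; exists f => //.
by exists 0.
Qed.

Lemma omega_le_dnum : ole omega dnum.
Proof.
have [D domD Dd] := dnumP; apply/oleNgt => ltd.
apply: (dominating_uncountable domD); rewrite /countable (card_le_eql Dd).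
by apply: (@ole_card dnum omega); left.
Qed.

Section LevelBound.
Variables (X : topologicalType) (mu : ordinal_number).
Hypotheses (flsX : FLS X) (limmu : limit_ordinal mu).
Hypothesis mu_gt_dnum : ~ ole (cf mu) dnum.

Let mu_gt_omega : ~ ole (cf mu) omega.
Proof. by move=> h; apply: mu_gt_dnum; exact: ole_trans omega_le_dnum. Qed.

(** By induction on the number of levels from [mu] upwards, up to [X^(mu)] the
    ranks in [F] are bounded below [mu].  Removing basic neighbourhoods
    [U t (g (e t))] of the points [t] of the countable discrete top level [T]
    leaves a set [F `\` O g] to which the induction applies, and larger functions
    [g] leave larger sets, so it is enough to bound [dnum] many of them. *)
Lemma closed_rank_bound m (F : set X) : closed F ->
  F `&` cb_deriv X (oaddn mu m) = set0 ->
  exists b : mu, F `&` cb_deriv X (oseg b) `<=` cb_deriv X mu.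
Proof.
have [hX fcX lX _] := flsX.
elim: m F => [|m IH] F cF Fm.
  have [b Fb] := lindelof_deriv_empty lX cF limmu mu_gt_omega Fm.
  by exists b; rewrite Fb; exact: sub0set.
set T := F `&` cb_deriv X (oaddn mu m).
have cT : closed T by apply: closedI => //; exact: closed_cb_deriv.
have /countable_injP[e einj] : countable T.
  apply: closed_discrete_countable => // x [Fx mx]; apply/isolatedP; split=> //.
  have /isolatedP[_ [V [oV Vx Vm]]] : isolated (cb_deriv X (oaddn mu m)) x.
    apply: contrapT => nx; have : (F `&` cb_deriv X (oaddn mu m.+1)) x.
      by split=> //; rewrite [oaddn _ _]/= cb_deriv_succ.
    by rewrite Fm.
  by exists V; split=> // y [Vy [_ my]]; exact: Vm.
have /choice[U UP] (x : X) := countable_base x fcX.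
pose O (g : nat -> nat) := \bigcup_(t in T) U t (g (e t)).
have Oopen g : open (O g) by apply: bigcup_open => t _; have [+ _ _] := UP t.
have Fg g : exists b : mu,
    (F `\` O g) `&` cb_deriv X (oseg b) `<=` cb_deriv X mu.
  apply: IH; first by apply: closedI => //; exact: open_closedC.
  apply/seteqP; split=> // t [[Ft nO] mt]; apply: nO; exists t => //.
  by have [_ + _] := UP t.
(* The domination is only modulo finite sets: the functions [maxn N (g n)] for
   [N : nat] make it everywhere. *)
have [D domD Dd] := dnumP.
have bD (g : baire) : exists b : mu, forall N,
    (F `\` O (fun n => maxn N (g n))) `&` cb_deriv X (oseg b)
      `<=` cb_deriv X mu.
  have /choice[f fP] N := Fg (fun n => maxn N (g n)).
  have [|b bP] := @cf_bounded mu omega (range f) mu_gt_omega.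
    exact: card_image_le.
  exists b => N x [nx bx]; apply: (fP N); split=> //; apply: cb_derivS bx.
  by left; apply: oseg_lt; apply: bP; exists N.
have {bD}/choice[f fP] := bD.
have [|b bP] := @cf_bounded mu dnum (f @` D) mu_gt_dnum.
  by rewrite -(card_le_eqr Dd) card_image_le.
exists b => x [Fx bx].
have [Tx|nTx] := pselect (T x).
  by case: Tx => _; apply: cb_derivS; exact: ole_oaddn.
(* Any function above [h] keeps [x], which is outside [T], in the set left. *)
have /choice[h hP] (n : nat) : exists k, forall t, T t -> e t = n ->
    forall j, (k <= j)%N -> ~ U t j x.
  have [[t [Tt tn]]|nt] := pselect (exists t, T t /\ e t = n); last first.
    by exists 0 => t Tt tn; case: nt; exists t.
  have [_ _ /(_ (~` [set x]))[|k kP]] := UP t.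
    apply: open_nbhs_nbhs; split; last by move=> tx; apply: nTx; rewrite -tx.
    apply: closed_openC; apply: accessible_closed_set1.
    exact: hausdorff_accessible.
  exists k => t' Tt' t'n j /kP sub; suff -> : t' = t by move=> /sub; exact.
  by apply: einj; rewrite ?inE// t'n.
have [g Dg [N _ gN]] := domD h.
pose N' := \max_(i < N) h i.
apply: (fP g N'); split; last first.
  by apply: cb_derivS bx; left; apply: oseg_lt; apply: bP; exists g.
split=> // -[t Tt]; apply: (hP (e t)) => //; rewrite leq_max.
have [/gN -> |] := leqP N (e t); first by rewrite orbT.
by move=> lt; rewrite (leq_bigmax (Ordinal lt) : (h (Ordinal lt) <= N')%N).
Qed.

(** Otherwise [X^(b)] would equal [X^(mu)] for some [b] below [mu], and have no
    isolated point. *)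
Lemma no_level_above n : cb_deriv X (oaddn mu n) = set0 -> cb_deriv X mu = set0.
Proof.
move=> mun; have [_ _ _ scX] := flsX.
have [|b] := @closed_rank_bound n setT closedT; first by rewrite setTI.
rewrite setTI => sub; apply/seteqP; split=> // x mux.
apply: (scattered_cb_deriv_lt scX _ (olt_seg b)) => //.
by exists x; apply: cb_derivS mux; left; exact: olt_seg.
Qed.

End LevelBound.

Lemma cf_olim_height (X : topologicalType) a : FLS X -> is_height X a ->
  ole (cf (olim a)) dnum.
Proof.
move=> flsX ha; have [limmu [n an]] := olimP a.
have [n0|n0] := posnP n.
  apply: ole_trans omega_le_dnum.
  by move: an; rewrite n0 => an; apply: cf_iso_le an _; exact: cf_height ha.
apply: contrapT => ncf.
have [|x mux] := @is_height_lt X a (olim a) ha.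
  case: n an n0 => // n /oiso_sym an _; apply: olt_iso an.
  by apply/olt_succE; exact: ole_oaddn.
suff : cb_deriv X (olim a) = set0 by move=> mu0; rewrite mu0 in mux.
apply: (@no_level_above X (olim a) flsX limmu ncf n).
by rewrite -(cb_deriv_iso _ an); case: ha.
Qed.

(** * Cardinality of first countable Lindelof Hausdorff spaces *)

Lemma card_set_continuum (A : countType) : [set: set A] #<= [set: set nat].
Proof.
apply: (@inj_card_leT _ _ (fun S : set A => choice.pickle @` S)).
suff sub (S R : set A) : choice.pickle @` S = choice.pickle @` R -> S `<=` R.
  by move=> S R SR; apply/seteqP; split; apply: sub.
move=> /seteqP[SR _] a Sa.
have [|b Rb] := SR (choice.pickle a); first by exists a.
by move=> /(pcan_inj (@choice.pickleK _)) <-.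
Qed.

Lemma card_fun_continuum (A B : countType) : [set: A -> B] #<= [set: set nat].
Proof.
apply: card_le_trans (card_set_continuum (A * B)%type).
apply: (@inj_card_leT _ _ (fun f => [set ab : A * B | f ab.1 = ab.2])).
move=> f g /seteqP[fg _]; apply/funext => a.
by have /fg : [set ab : A * B | f ab.1 = ab.2] (a, f a) by [].
Qed.

Lemma card_prod_continuum (T U : Type) : [set: T] #<= [set: set nat] ->
  [set: U] #<= [set: set nat] -> [set: T * U] #<= [set: set nat].
Proof.
move=> /card_leT_inj[f finj] /card_leT_inj[g ginj].
apply: card_le_trans (card_set_continuum (nat + nat)%type).
apply: (@inj_card_leT _ _ (fun tu => [set s : nat + nat |
  match s with inl m => f tu.1 m | inr m => g tu.2 m end])).
move=> [t u] [t' u'] /= E; congr pair; [apply: finj|apply: ginj];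
  apply/funext => m.
  exact: (congr1 (fun S : set (nat + nat) => S (inl m)) E).
exact: (congr1 (fun S : set (nat + nat) => S (inr m)) E).
Qed.

(** The points generated from one point by countable-arity operations indexed by
    [option (nat -> nat)] are the values of these terms, so there are at most
    continuum many. *)
Inductive term := Const | Op of option (nat -> nat) & (nat -> term).

(** A term is a countably branching tree; [p] is a position in it, and the label
    found there is turned into a function, shifted so that [Const], [None] and
    [Some k] stay distinct. *)
Fixpoint term_code (t : term) (p : seq nat) (i : nat) : nat :=
  match t with
  | Const => 0
  | Op l s => match p with
    | [::] => if l is Some k then (k i).+2 else 1
    | n :: q => term_code (s n) q i
    end
  end.

Lemma term_code_inj t u : term_code t =2 term_code u -> t = u.
Proof.
elim: t u => [|l s IH] [|l' s'] // tu.
- by have := tu [::] 0 => /=; case: l' {tu}.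
- by have := tu [::] 0 => /=; case: l {tu}.
congr Op; last by apply/funext => n; apply: IH => p i; exact: tu (n :: p) i.
have {}tu i := tu [::] i; case: l l' tu {IH} => [k|] [k'|] //= tu.
- by congr Some; apply/funext => i; have [] := tu i.
- by have := tu 0.
- by have := tu 0.
Qed.

Lemma card_term : [set: term] #<= [set: set nat].
Proof.
apply: card_le_trans (card_fun_continuum (seq nat * nat)%type nat).
apply: (@inj_card_leT _ _ (fun t pi => term_code t pi.1 pi.2)) => t u tu.
by apply: term_code_inj => p i; have /(congr1 (fun f => f (p, i))) := tu.
Qed.

Lemma lindelof_sequence (X : topologicalType) (H : set X) (W : X -> set X) :
  lindelof X -> closed H -> H !=set0 ->
  (forall y, H y -> open (W y) /\ W y y) ->
  exists y : nat -> X, (forall n, H (y n)) /\ H `<=` \bigcup_n W (y n).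
Proof.
move=> lX cH [y0 Hy0] WP.
have [||D [DC cD DT]] := lX [set V | V = ~` H \/ exists2 y, H y & V = W y].
- by move=> V [->|[y /WP[oW _] ->]] //; exact: closed_openC.
- apply/seteqP; split=> // y _; have [Hy|nHy] := pselect (H y).
    by exists (W y); [right; exists y|case: (WP y Hy)].
  by exists (~` H) => //; left.
have /choice[f fP] (V : set X) : exists y, H y /\ (D V -> V `&` H `<=` W y).
  have [/DC[->|[y Hy ->]]|nDV] := pselect (D V); last by exists y0.
    by exists y0; split=> // _ x [].
  by exists y; split=> // _ x [].
have /pfcard_geP[D0|/surjfunPex[e De]] := cD.
  by have : [set: X] y0 by []; rewrite -DT D0 => -[].
exists (f \o e); split=> [n|y Hy]; first by have [] := fP (e n).
have : [set: X] y by []; rewrite -DT => -[V DV Vy].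
have := DV; rewrite De => -[n _ eV]; exists n => //=.
by rewrite eV; apply: (fP V).2.
Qed.

(** Let [H] be the set of values of all terms, where the unlabelled operation
    sends a sequence to its limit and the operation labelled [k] sends [y] to
    some point outside all [U (y n) (k n)].  The former makes [H] closed, hence
    Lindelof, and then a point outside [H] would yield countably many
    [U (y n) (k n)] covering [H] but not the space, against the latter. *)
Lemma card_FLS (X : topologicalType) : hausdorff_space X -> first_countable X ->
  lindelof X -> [set: X] #<= [set: set nat].
Proof.
move=> hX fcX lX.
have [[x0 _]|X0] := pselect ([set: X] !=set0); last first.
  have -> : [set: X] = set0 by apply: contrapT => /eqP/set0P.
  exact: card_ge0.
have /choice[U UP] (x : X) := countable_base x fcX.
(* Two points near the same sequence, in the sense of the [None] case, coincide
   since the space is Hausdorff. *)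
pose Q l (s : nat -> X) x := if l is Some k
  then forall n, ~ U (s n) (k n) x else forall n : nat, U x n (s n).
have /choice[op opP] (ls : option (nat -> nat) * (nat -> X)) :
    exists x, (exists y, Q ls.1 ls.2 y) -> Q ls.1 ls.2 x.
  have [[y Qy]|nQ] := pselect (exists y, Q ls.1 ls.2 y); first by exists y.
  by exists x0.
pose fix eval t := if t is Op l s then op (l, fun n => eval (s n)) else x0.
have cH : closed (range eval).
  move=> x Hx; have /choice[t tP] n : exists t, U x n (eval t).
    have [|_ [[t _ <-] Ut]] := Hx (U x n); last by exists t.
    by apply: open_nbhs_nbhs; have [? ? _] := UP x.
  exists (Op None t) => //=; set y := op _.
  have Qy : Q None (fun n => eval (t n)) y.
    by apply: (opP (None, fun n => eval (t n))); exists x.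
  apply: contrapT => /eqP yx; move: hX; rewrite open_hausdorff.
  move=> /(_ _ _ yx)[[A B] /= [/set_mem yA /set_mem xB] [oA oB /eqP AB]].
  have [_ _ /(_ A)[|N NA]] := UP y; first exact: open_nbhs_nbhs.
  have [_ _ /(_ B)[|M MB]] := UP x; first exact: open_nbhs_nbhs.
  have : (A `&` B) (eval (t (maxn N M))).
    split; [apply: (NA (maxn N M))|apply: (MB (maxn N M))] => //.
      exact: leq_maxl.
    exact: leq_maxr.
  by rewrite AB.
suff sur x : range eval x.
  apply: card_le_trans card_term.
  apply: card_le_trans (card_image_le eval setT).
  by apply: subset_card_le => x _.
apply: contrapT => nHx.
have /choice[k kP] y : exists k, range eval y -> ~ U y k x.
  have [Hy|nHy] := pselect (range eval y); last by exists 0.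
  have [_ _ /(_ (~` [set x]))[|k kU]] := UP y.
    apply: open_nbhs_nbhs; split; last by move=> yx; apply: nHx; rewrite -yx.
    apply: closed_openC; apply: accessible_closed_set1.
    exact: hausdorff_accessible.
  by exists k => _ /(kU _ (leqnn k)); apply.
have [|y Hy|y [Hy yU]] := @lindelof_sequence X _ (fun y => U y (k y)) lX cH.
- by exists x0, Const.
- by have [? ? _] := UP y.
have /choice[t tP] n : exists t, eval t = y n by have [t _] := Hy n; exists t.
pose z := op (Some (k \o y), fun n => eval (t n)).
have Qz : Q (Some (k \o y)) (fun n => eval (t n)) z.
  apply: (opP (_, _)); exists x => n /=; rewrite tP; exact: kP.
have [|n _] := yU z; first by exists (Op (Some (k \o y)) t).
by have := Qz n; rewrite tP.
Qed.

Lemma height_lt_csucc (X : topologicalType) a : FLS X -> is_height X a ->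
  olt a (csucc continuum).
Proof.
move=> [hX fcX lX scX] ha; apply/olt_csuccP.
apply: card_le_trans (card_FLS hX fcX lX).
apply: card_nonempty_derivatives => // x.
by apply: (is_height_lt ha); exact: olt_seg.
Qed.

(** * Layered sums *)

Definition agree (k : nat) (u v : nat -> bool) :=
  forall i, (i < k)%N -> u i = v i.

Lemma agreeW k l u v : (k <= l)%N -> agree l u v -> agree k u v.
Proof. by move=> kl uv i ik; apply: uv; exact: leq_trans kl. Qed.

Lemma agree_sym k u v : agree k u v -> agree k v u.
Proof. by move=> uv i /uv. Qed.

Lemma agree_trans k u v w : agree k u v -> agree k v w -> agree k u w.
Proof. by move=> uv vw i ik; rewrite uv// vw. Qed.

Lemma not_agree u v : u <> v -> exists k, ~ agree k u v.
Proof.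
move=> uv; apply: contrapT => nuv; apply: uv; apply/funext => i.
apply: contrapT => ui; apply: nuv; exists i.+1 => uv; apply: ui; exact: uv.
Qed.

Lemma existT_injr (T : Type) (P : T -> Type) (x : T) (a b : P x) :
  existT P x a = existT P x b -> a = b.
Proof. exact: (@existT_inj2 {classic T}). Qed.

(** The carrier ignores the codes [phi] and the ranks [r], which are arguments
    because the topology put on it below is found by its type. *)
Definition layered (Y : Type) (phi : Y -> nat -> bool) (r : Y -> nat)
  (X : Y -> topologicalType) : Type := {y : Y & X y}.

Section LayeredTopology.
Variables (Y : Type) (phi : Y -> nat -> bool) (r : Y -> nat).
Variable X : Y -> topologicalType.
Local Notation Z := (layered phi r X).

HB.instance Definition _ := gen_eqMixin Z.
HB.instance Definition _ := gen_choiceMixin Z.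

(** Besides being open in each fibre, a set containing a point over [y] has to
    contain the whole fibres over all indices of smaller rank whose code is
    close to that of [y]. *)
Definition layered_open (W : set Z) : Prop :=
  (forall y, open [set x | W (existT _ y x)]) /\
  forall z, W z -> exists k, forall z' : Z, (r (projT1 z') < r (projT1 z))%N ->
    agree k (phi (projT1 z')) (phi (projT1 z)) -> W z'.

Let layered_openT : layered_open setT.
Proof. by split=> [y|z _]; [exact: openT|exists 0]. Qed.

Let layered_openI : setI_closed layered_open.
Proof.
move=> A B [oA nA] [oB nB]; split=> [y|z [/nA[k kA] /nB[l lB]]].
  by apply: openI; [exact: oA|exact: oB].
exists (maxn k l) => z' rz' a; split; [apply: kA|apply: lB] => //.
  by apply: agreeW a; exact: leq_maxl.
by apply: agreeW a; exact: leq_maxr.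
Qed.

Let layered_open_bigU (I : Type) (f : I -> set Z) :
  (forall i, layered_open (f i)) -> layered_open (\bigcup_i f i).
Proof.
move=> of_; split=> [y|z [i _ fiz]].
  have -> : [set x | (\bigcup_i f i) (existT _ y x)] =
      \bigcup_i [set x | f i (existT _ y x)] by [].
  by apply: bigcup_open => i _; exact: (of_ i).1.
have [k kf] := (of_ i).2 _ fiz.
by exists k => z' rz' a; exists i => //; exact: kf.
Qed.

HB.instance Definition _ := isOpenTopological.Build Z
  layered_openT layered_openI layered_open_bigU.

Lemma layered_openE : @open Z = layered_open.
Proof. by []. Qed.

(** When [O] is open in the fibre over [y] and contains [x], this is a basic
    neighbourhood of [existT _ y x]. *)
Definition layered_nbhd (y : Y) (O : set (X y)) (k : nat) : set Z :=
  existT _ y @` O `|`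
  [set z | (r (projT1 z) < r y)%N /\ agree k (phi (projT1 z)) (phi y)].

Local Arguments layered_nbhd : clear implicits.

Lemma open_layered_nbhd y O k : open O -> open (layered_nbhd y O k).
Proof.
move=> oO; rewrite layered_openE; split=> [y'|z].
  have [->|yy'] := pselect (y' = y).
    suff -> : [set x | layered_nbhd y O k (existT _ y x)] = O by [].
    apply/seteqP; split=> x /=; last by left; exists x.
    case=> [[x' Ox']|[]]; last by rewrite ltnn.
    by move=> e; rewrite -(existT_injr e).
  have [[ry a]|nry] := pselect ((r y' < r y)%N /\ agree k (phi y') (phi y)).
    suff -> : [set x | layered_nbhd y O k (existT _ y' x)] = setT.
      exact: openT.
    by apply/seteqP; split=> // x _; right.
  suff -> : [set x | layered_nbhd y O k (existT _ y' x)] = set0 by exact: open0.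
  apply/seteqP; split=> // x [[x' _ /(congr1 (@projT1 _ _)) /= yy]|//].
  by case: yy'.
case=> [[x Ox <-]|[ry a]] /=.
  by exists k => z' rz' a; right.
exists k => z' rz' a'; right; split; first exact: ltn_trans ry.
exact: agree_trans a' a.
Qed.

Lemma layered_nbhs (y : Y) (x : X y) (W : set Z) : nbhs (existT _ y x : Z) W ->
  exists2 k, layered_nbhd y [set x' | W (existT _ y x')]° k `<=` W &
    [set x' | W (existT _ y x')]° x.
Proof.
rewrite nbhsE => -[V [oV Vx] VW].
have [oVy /(_ _ Vx)[k kV]] : layered_open V by [].
have sub : [set x' | V (existT _ y x')] `<=` [set x' | W (existT _ y x')]°.
  by rewrite -open_subsetE// => x' /VW.
exists k; last exact: sub.
move=> z [[x' /interior_subset Wx' <-]//|[rz a]].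
by apply: VW; exact: kV.
Qed.

Lemma open_slice (W : set Z) y : open W -> open [set x | W (existT _ y x)].
Proof. by move=> [+ _]; exact. Qed.

Section LayeredFLS.
Hypothesis phi_inj : injective phi.
Hypothesis positive_singleton : forall y, (0 < r y)%N ->
  exists x0 : X y, forall x, x = x0.
Hypothesis flsX : forall y, FLS (X y).

(** Over distinct indices, points are separated by their codes; two points of
    one fibre only occur at rank [0], where fibres are open. *)
Lemma layered_hausdorff : hausdorff_space Z.
Proof.
rewrite open_hausdorff => -[y x] [y' x'] /eqP zz'.
have [yy'|yy'] := pselect (y = y'); last first.
  have [k nk] : exists k, ~ agree k (phi y) (phi y').
    by apply: not_agree => /phi_inj.
  exists (layered_nbhd y setT k : set Z, layered_nbhd y' setT k : set Z) => /=.
    split; apply/mem_set; left; [by exists x|by exists x'].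
  split; try by apply: open_layered_nbhd; exact: openT.
  apply/eqP/seteqP; split=> // z [zy zy']; apply: nk.
  have near y0 : layered_nbhd y0 setT k z -> agree k (phi (projT1 z)) (phi y0).
    by case=> [[x0 _ <-]|[]].
  exact: agree_trans (agree_sym (near _ zy)) (near _ zy').
subst y'; have ry : r y = 0.
  apply/eqP; rewrite -leqn0 leqNgt; apply/negP => /positive_singleton[x0 xx0].
  by apply: zz'; rewrite (xx0 x) (xx0 x').
have [hX _ _ _] := flsX y; move: hX; rewrite open_hausdorff.
have xx' : x != x' by apply/eqP => xx'; apply: zz'; rewrite xx'.
move=> /(_ x x' xx')[[A B] /= [/set_mem Ax /set_mem Bx'] [oA oB /eqP AB]].
exists (layered_nbhd y A 0 : set Z, layered_nbhd y B 0 : set Z) => /=.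
  by split; apply/mem_set; left; [exists x|exists x'].
split; try exact: open_layered_nbhd.
apply/eqP/seteqP; split=> // z [[[u Au <-]|[]]]; last by rewrite ry.
case=> [[v Bv vu]|[]]; last by rewrite ry.
have : (A `&` B) u by split=> //; rewrite -(existT_injr vu).
by rewrite AB.
Qed.

Lemma layered_first_countable : first_countable Z.
Proof.
move=> [y x]; have [_ fcX _ _] := flsX y; have [B cB [Bx BV]] := fcX x.
exists [set W | exists V k, B V /\ W = layered_nbhd y V° k].
  have -> : [set W | exists V k, B V /\ W = layered_nbhd y V° k] =
      (fun Vk => layered_nbhd y Vk.1° Vk.2 : set Z) @` (B `*` [set: nat]).
    apply/seteqP; split=> [_ [V [k [BVV ->]]]|_ [[V k] [/= BVV _] <-]].
      by exists (V, k).
    by exists V, k.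
  apply: sub_countable (card_image_le _ _) _.
  by apply: countableX => //; exact: countableP.
split=> [_ [V [k [/Bx Vx ->]]]|W].
  apply: open_nbhs_nbhs; split.
    by apply: open_layered_nbhd; exact: open_interior.
  by left; exists x.
move=> /layered_nbhs[k kW Wx].
have [|V BVV VW] := BV ([set x' | W (existT _ y x')]°).
  by apply: open_nbhs_nbhs; split=> //; exact: open_interior.
exists (layered_nbhd y V° k); first by exists V, k.
apply: subset_trans kW; move=> z [[x' Vx' <-]|]; last by right.
by left; exists x' => //; apply: VW; exact: interior_subset Vx'.
Qed.

(** Among the points of a set, one of least rank is isolated as soon as it is
    isolated in the trace of the set on its fibre. *)
Lemma layered_scattered : scattered Z.
Proof.
move=> A [z0 Az0].
have [n [z Az zn] nmin] : exists2 n, (exists2 z, A z & r (projT1 z) = n) &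
    forall z, A z -> (n <= r (projT1 z))%N.
  have exr : exists n, `[< exists2 z, A z & r (projT1 z) = n >].
    by exists (r (projT1 z0)); apply/asboolP; exists z0.
  case: (ex_minnP exr) => n /asboolP nz nP; exists n => // z Az.
  by apply: nP; apply/asboolP; exists z.
case: z Az zn => y x0 Ax0 /= ry.
have [_ _ _ scX] := flsX y.
have [|x /isolatedP[Ax [O [oO Ox OA]]]] := scX [set x | A (existT _ y x)].
  by exists x0.
exists (existT _ y x); apply/isolatedP; split=> //.
exists (layered_nbhd y O 0); split; first exact: open_layered_nbhd.
  by left; exists x.
move=> z [[[x' Ox' <-]|[rz _]] Az]; last first.
  by have := nmin _ Az; rewrite leqNgt -ry rz.
by rewrite (OA x' (conj Ox' Az)).
Qed.

(** Each index [y] comes with countably many members of a cover that contain the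
    fibre over [y] and all fibres over indices of smaller rank whose code agrees
    with that of [y] up to some [k y].  Only the rank of [y] and the first [k y]
    values of its code matter for the latter, so countably many [y] do the work
    of all of them, and they miss only the countable set of the hypothesis. *)
Lemma layered_lindelof :
  (forall k : Y -> nat, countable [set y | forall x, (r y < r x)%N ->
    ~ agree (k x) (phi y) (phi x)]) -> lindelof Z.
Proof.
move=> cov C Copen CT.
have cC z : exists2 V, C V & V z.
  by have : [set: Z] z by []; rewrite -CT => -[V CV Vz]; exists V.
have [[y0 _]|Y0] := pselect (exists y : Y, True); last first.
  exists set0; split; [by []|exact: countable0|].
  by apply/seteqP; split=> // -[y x]; case: Y0; exists y.
have /choice[kD kDP] (y : Y) : exists kD : nat * set (set Z),
    [/\ kD.2 `<=` C, countable kD.2 & forall z : Z, projT1 z = y \/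
      (r (projT1 z) < r y)%N /\ agree kD.1 (phi (projT1 z)) (phi y) ->
      exists2 V, kD.2 V & V z].
  have [ry|ry] := posnP (r y).
    have [_ _ lX _] := flsX y.
    have [||D [DC cD DT]] :=
      lX ((fun V : set Z => [set x | V (existT _ y x)]) @` C).
    - by move=> _ [V CV <-]; apply: open_slice; exact: Copen.
    - apply/seteqP; split=> // x _; have [V CV Vx] := cC (existT _ y x).
      by exists [set x | V (existT _ y x)] => //; exists V.
    have /choice[f fP] (S : set (X y)) : exists V : set Z,
        D S -> C V /\ [set x | V (existT _ y x)] = S.
      have [/DC[V CV VS]|nDS] := pselect (D S); last by exists set0.
      by exists V.
    exists (0, f @` D); split=> /= [_ [S /fP[? _] <-] //||].
      exact: sub_countable (card_image_le _ _) cD.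
    move=> [y' x] /= [yy'|[]]; last by rewrite ry.
    subst y'; have : [set: X y] x by []; rewrite -DT => -[S DS Sx].
    exists (f S); first by exists S.
    by have [_ fS] := fP S DS; rewrite -fS in Sx.
  have [x0 xx0] := positive_singleton ry.
  have [V CV Vx0] := cC (existT _ y x0).
  have [_ /(_ _ Vx0)[k kV]] := Copen _ CV.
  exists (k, [set V]); split=> /= [_ -> //||]; first exact: countable1.
  move=> z zy; exists V => //; case: zy => [|[rz a]]; last exact: kV.
  by case: z => y' x /= yy'; subst y'; rewrite (xx0 x).
pose key y := (mkseq (phi y) (kD y).1, r y).
have /choice[rep repP] (c : seq bool * nat) :
    exists y, (exists x, key x = c) -> key y = c.
  by have [[x xc]|nx] := pselect (exists x, key x = c); [exists x|exists y0].
set E := [set y | forall x, (r y < r x)%N -> ~ agree (kD x).1 (phi y) (phi x)].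
have cE : countable E := cov (fun x => (kD x).1).
exists (\bigcup_(y in E `|` range rep) (kD y).2); split.
- by move=> V [y _ DV]; have [DC _ _] := kDP y; exact: DC.
- apply: bigcup_countable => [|y _]; last by have [] := kDP y.
  apply: countableU cE _.
  exact: sub_countable (card_image_le _ _) (countableP _).
apply/seteqP; split=> // z _.
have [Ez|/existsNP[x /not_implyP[rx /contrapT a]]] := pselect (E (projT1 z)).
  have [_ _ /(_ z)[|V DV Vz]] := kDP (projT1 z); first by left.
  by exists V => //; exists (projT1 z) => //; left.
have [kx rx'] : key (rep (key x)) = key x by apply: repP; exists x.
have [_ _ /(_ z)[|V DV Vz]] := kDP (rep (key x)); last first.
  by exists V => //; exists (rep (key x)) => //; right; exists (key x).
right; rewrite rx'; split=> //.
have kk : (kD (rep (key x))).1 = (kD x).1.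
  by have := congr1 size kx; rewrite !size_mkseq.
move=> i ik; rewrite a -?kk//.
have := congr1 (fun s => nth false s i) kx.
by rewrite !nth_mkseq -?kk// => ->.
Qed.

Lemma layered_FLS :
  (forall k : Y -> nat, countable [set y | forall x, (r y < r x)%N ->
    ~ agree (k x) (phi y) (phi x)]) -> FLS Z.
Proof.
move=> cov; split; [exact: layered_hausdorff|exact: layered_first_countable| |
  exact: layered_scattered].
exact: layered_lindelof.
Qed.

(** Slices of neighbourhoods are neighbourhoods, so a point that is isolated at
    some level of the layered space is isolated at that level of its fibre. *)
Lemma fibre_deriv y x b : cb_deriv (X y) b x -> cb_deriv Z b (existT _ y x).
Proof.
elim/(well_founded_ind olt_wf): b x => b IH x; rewrite !cb_derivE => Hx c cb.
have [cx nx] := Hx c cb; split; first exact: IH.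
move=> /isolatedP[_ [V [oV Vx VA]]]; apply: nx; apply/isolatedP; split=> //.
exists [set x | V (existT _ y x)]; split=> //; first exact: open_slice.
move=> x' [Vx' cx']; have := VA (existT _ y x') (conj Vx' (IH c cb _ cx')).
exact: existT_injr.
Qed.

(** Fibres over indices of rank [0] are open. *)
Lemma bottom_deriv y x b : r y = 0 ->
  cb_deriv Z b (existT _ y x) -> cb_deriv (X y) b x.
Proof.
move=> ry; elim/(well_founded_ind olt_wf): b x => b IH x.
rewrite !cb_derivE => Hx c cb.
have [cx nx] := Hx c cb; split; first exact: IH.
move=> /isolatedP[_ [V [oV Vx VA]]]; apply: nx; apply/isolatedP; split=> //.
exists (layered_nbhd y V 0); split; first exact: open_layered_nbhd.
  by left; exists x.
move=> z [[[x' Vx' <-]|[]]]; last by rewrite ry.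
by move=> cx'; rewrite (VA x' (conj Vx' (IH c cb _ cx'))).
Qed.

(** Once the fibres of rank [0] are exhausted, every further derivative removes
    one more rank: the remaining points of least rank are isolated, since their
    fibres are singletons. *)
Lemma layered_deriv_rank a n : (forall y, r y = 0 -> cb_deriv (X y) a = set0) ->
  forall z, cb_deriv Z (oaddn a n) z -> (n < r (projT1 z))%N.
Proof.
move=> a0; elim: n => [|n IH] [y x].
  move=> /= ax; rewrite lt0n; apply/eqP => ry.
  by have := bottom_deriv ry ax; rewrite a0.
rewrite [oaddn _ _]/= cb_deriv_succ => -[/[dup] nx /IH /= ny niso].
rewrite ltn_neqAle ny andbT; apply/eqP => yn; apply: niso; apply/isolatedP.
split=> //; exists (layered_nbhd y setT 0); split.
- by apply: open_layered_nbhd; exact: openT.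
- by left; exists x.
move=> z [[[x' _ <-] _|[rz _] /IH]]; last by rewrite ltnNge -ltnS yn rz.
have [|x0 xx0] := @positive_singleton y; first by rewrite -yn.
by rewrite (xx0 x) (xx0 x').
Qed.

End LayeredFLS.
End LayeredTopology.

(** * A Bernstein decomposition of the Cantor space *)

(** Closedness in the Cantor space. *)
Definition agree_closed (K : set (nat -> bool)) :=
  forall x, (forall k, exists2 y, K y & agree k x y) -> K x.

(** Discarding the countable basic pieces of [K], whose union [C] is countable,
    leaves a set without isolated points, in which a Cantor scheme can be
    built. *)
Lemma perfect_set K : agree_closed K -> ~ countable K ->
  [set: nat -> bool] #<= K.
Proof.
move=> clK ncK.
pose piece k x := K `&` [set y | agree k x y].
pose cyl (s : seq bool) := K `&` [set y | agree (size s) (nth false s) y].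
pose C := \bigcup_(s in [set s | countable (cyl s)]) cyl s.
have cC : countable C by apply: bigcup_countable => [|s //]; exact: countableP.
have big x k : (K `\` C) x -> ~ countable (piece k x).
  move=> [Kx nCx] cp; apply: nCx.
  have pE : cyl (mkseq x k) = piece k x.
    rewrite /cyl size_mkseq; apply/seteqP; split=> y [Ky a]; split=> // i ik.
      by rewrite -(a i ik) nth_mkseq.
    by rewrite nth_mkseq// a.
  by exists (mkseq x k); rewrite /= pE.
have splits x k : (K `\` C) x ->
    exists2 y, (K `\` C) y & agree k x y /\ exists2 j, (k <= j)%N & x j != y j.
  move=> Kx; apply: contrapT => nsplit; apply: (big x k Kx).
  apply: (@sub_countable _ _ _ (C `|` [set x])); last first.
    exact: countableU cC (countable1 x).
  apply: subset_card_le => y [Ky a].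
  have [Cy|nCy] := pselect (C y); [by left|right].
  apply: contrapT => yx; apply: nsplit; exists y => //; split=> //.
  have [j nj] : exists j, x j != y j.
    apply: contrapT => nj; apply: yx; apply/funext => i; apply/eqP.
    by rewrite eq_sym; apply: contrapT => /negP xy; apply: nj; exists i.
  by exists j => //; rewrite leqNgt; apply/negP => /a; apply/eqP.
have [x0 Kx0] : K `\` C !=set0.
  apply/set0P/eqP => KC; apply: ncK; apply: sub_countable cC.
  apply: subset_card_le => x Kx; apply: contrapT => nCx.
  by have : (K `\` C) x by []; rewrite KC.
have /choice[nx nxP] (st : (nat -> bool) * nat) :
    exists yj : (nat -> bool) * nat, (K `\` C) st.1 ->
    [/\ (K `\` C) yj.1, agree st.2 st.1 yj.1, (st.2 <= yj.2)%N &
        st.1 yj.2 != yj.1 yj.2].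
  have [/(splits _ st.2)[y Ky [a [j kj xy]]]|nK] := pselect ((K `\` C) st.1).
    by exists (y, j).
  by exists st.
(* [S w n = (x, k)] commits the branch along [w] to the first [k] values of [x];
   the next bit of [w] decides between [x] and a point [y] of [K `\` C] that
   agrees with [x] up to [k] but not at some later index. *)
pose fix S (w : nat -> bool) n : (nat -> bool) * nat := if n is m.+1 then
  (if w m then (nx (S w m)).1 else (S w m).1, (nx (S w m)).2.+1) else (x0, 0).
have SK w n : (K `\` C) (S w n).1.
  by elim: n => //= n IH; have [? _ _ _] := nxP _ IH; case: ifP.
have Sagree w n m : (n <= m)%N ->
    agree (S w n).2 (S w n).1 (S w m).1 /\ ((S w n).2 <= (S w m).2)%N.
  elim: m => [|m IH]; first by rewrite leqn0 => /eqP ->.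
  rewrite leq_eqVlt => /orP[/eqP ->//|/IH[a le]].
  have [_ a' le' _] := nxP _ (SK w m); split=> /=; last first.
    by apply: leq_trans le _; exact: ltnW.
  by case: ifP => // _; apply: agree_trans a _; exact: agreeW a'.
have Slt w n : (n <= (S w n).2)%N.
  elim: n => //= n IH; have [_ _ le _] := nxP _ (SK w n).
  by rewrite ltnS; exact: leq_trans le.
pose z w i := (S w i.+1).1 i.
have zS w n : agree (S w n).2 (S w n).1 (z w).
  move=> i ik; rewrite /z; have [ni|] := leqP n i.+1.
    by have [a _] := Sagree w n _ ni; rewrite a.
  by move=> /ltnW /(Sagree w)[a _]; rewrite a//; exact: Slt.
have zK w : K (z w).
  apply: clK => k; exists (S w k).1; first by have [] := SK w k.
  by apply: agree_sym; apply: agreeW (zS w k); exact: Slt.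
have zinj : injective z.
  move=> w w' zz; apply/funext.
  suff main n : agree n w w' by move=> i; exact: (main i.+1).
  elim: n => [|n IH] i //; rewrite ltnS leq_eqVlt => /orP[/eqP->|/IH//].
  have SS : S w n = S w' n.
    move: IH; elim: n {i} => //= n IHn wa.
    by rewrite wa// IHn// => i ni; apply: wa; exact: ltnW.
  have [_ _ _ ne] := nxP _ (SK w n); apply: contrapT => wn.
  have := zS w n.+1 (nx (S w n)).2; have := zS w' n.+1 (nx (S w' n)).2.
  rewrite /= zz -SS => /(_ (ltnSn _)) <- /(_ (ltnSn _)).
  by move: wn ne; case: (w n) (w' n) => -[] //= _ /eqP // ne e; apply: ne.
have KE : z @` setT `<=` K by move=> _ [w _ <-].
apply: card_le_trans (subset_card_le KE).
by have := @inj_card_eq _ _ setT z (in2W zinj); rewrite card_eq_le => /andP[].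
Qed.

Lemma card_cantor : [set: set nat] #<= [set: nat -> bool].
Proof.
apply: (@inj_card_leT _ _ (fun S n => `[< S n >])) => S S' /funeqP SS'.
by apply/seteqP; split=> n /asboolP; [rewrite SS'|rewrite -SS'] => /asboolP.
Qed.

Lemma uncountable_cantor : ~ countable [set: nat -> bool].
Proof. by move=> /(card_le_trans card_cantor)/Cantor. Qed.

(** Transfinite recursion: points chosen in the sets [K x] can be kept distinct
    as long as [K x] is not exhausted by the choices made before [x]. *)
Lemma wo_distinct_choice (a : ordinal_number) (T : Type) (K : a -> set T) :
  (exists t : T, True) ->
  exists p : a -> T, forall x,
    (forall A : set T, A #<= [set: oseg x] -> ~ K x `<=` A) ->
    K x (p x) /\ forall y, ~~ leo x y -> p y <> p x.
Proof.
move=> [t0 _].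
pose R (y x : a) := ~~ leo x y.
have Rwf : well_founded R.
  suff acc b x : oseg x = b -> Acc R x by move=> x; exact: acc erefl.
  elim/(well_founded_ind olt_wf): b x => b IH x xb.
  constructor=> y yx; apply: IH erefl; rewrite -xb; exact: oseg_lt.
pose good x (rec : forall y, R y x -> T) t :=
  K x t /\ forall y yx, rec y yx <> t.
have /choice[pick pickP] (u : {x : a & forall y, R y x -> T}) :
    exists t, (exists t', @good _ (projT2 u) t') -> @good _ (projT2 u) t.
  have [[t gt]|ng] := pselect (exists t', @good _ (projT2 u) t').
    by exists t.
  by exists t0.
pose F x rec := pick (existT _ x rec).
pose p := Fix Rwf (fun=> T) F.
have pE x : p x = F x (fun y _ => p y).
  rewrite /p Fix_eq// => {}x f g fg; congr (F x).
  by apply/functional_extensionality_dep => y; apply/funext => yx.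
exists p => x big.
have [t gt] : exists t, @good x (fun y _ => p y) t.
  apply: contrapT => nt; apply: (big (range (fun y : oseg x => p (sval y)))).
    exact: card_image_le.
  move=> t Kt; apply: contrapT => nrt; apply: nt; exists t; split=> // y yx pyt.
  by apply: nrt; exists (exist _ y yx).
have [Kp np] := pickP (existT _ x (fun y _ => p y)) (ex_intro _ t gt).
by rewrite pE; split.
Qed.

Definition branches (t : set (seq bool)) : set (nat -> bool) :=
  [set x | forall k, t (mkseq x k)].

Lemma agree_mkseq k (x y : nat -> bool) : mkseq x k = mkseq y k <-> agree k x y.
Proof.
split=> [xy i ik|xy].
  by have := congr1 (fun s => nth false s i) xy; rewrite !nth_mkseq.
by apply/eq_in_map => i; rewrite mem_iota => /andP[_]; exact: xy.
Qed.

(** Closed sets are coded by sets of finite sequences, so there are at most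
    continuum many. *)
Lemma branchesK K : agree_closed K ->
  branches [set s | exists2 x, K x & mkseq x (size s) = s] = K.
Proof.
move=> clK; apply/seteqP; split=> x Kx; last first.
  by move=> k; exists x => //; rewrite size_mkseq.
apply: clK => k; have [y Ky] := Kx k.
by rewrite size_mkseq => /agree_mkseq /agree_sym xy; exists y.
Qed.

Lemma agree_closed_branches t : agree_closed (branches t).
Proof. by move=> x clx k; have [y /(_ k) + /agree_mkseq ->] := clx k. Qed.

(** Enumerate in type [continuum] all pairs of a closed set and a value; each
    uncountable closed set has continuum many points, so at its stages points not
    used before can be chosen in it and sent to the prescribed values. *)
Lemma bernstein (V : Type) (v0 : V) : [set: V] #<= [set: set nat] ->
  exists F : (nat -> bool) -> V, forall K, agree_closed K -> ~ countable K ->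
    forall v, exists2 x, K x & F x = v.
Proof.
move=> cV.
have /(card_leT_surj (set0, v0))[e eP] :
    [set: set (seq bool) * V] #<= [set: continuum].
  rewrite -(card_le_eqr continuum_card); apply: card_prod_continuum => //.
  exact: card_set_continuum.
have [|p pP] := @wo_distinct_choice continuum _ (fun x => branches (e x).1).
  by exists (fun=> false).
have {}pP x : ~ countable (branches (e x).1) ->
    branches (e x).1 (p x) /\ forall y, ~~ leo x y -> p y <> p x.
  move=> nc; apply: pP => A Ax Ksub.
  (* Since [continuum] is an initial ordinal, its proper initial segments have
     smaller cardinality. *)
  have cx : [set: set nat] #<= [set: oseg x].
    apply: card_le_trans Ax; apply: card_le_trans (subset_card_le Ksub).
    apply: card_le_trans (perfect_set (@agree_closed_branches _) nc).
    exact: card_cantor.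
  have : ole continuum (oseg x).
    apply: (oleastP (ordinal_of_type _)).2; rewrite card_eq_le cx /=.
    rewrite (card_le_eqr continuum_card).
    exact: (@ole_card (oseg x) continuum (or_introl (olt_seg x))).
  by apply/oltNge; exact: olt_seg.
have /choice[F FP] (x : nat -> bool) : exists v, forall i,
    ~ countable (branches (e i).1) -> p i = x -> v = (e i).2.
  have [[i [nci <-]]|ni] :=
    pselect (exists i, ~ countable (branches (e i).1) /\ p i = x).
    exists (e i).2 => j ncj ji; suff -> : j = i by [].
    apply: leo_anti; apply: contrapT => /negP.
      by move=> /(pP j ncj).2; rewrite ji; apply.
    by move=> /(pP i nci).2; rewrite ji; apply.
  by exists v0 => i nci pix; case: ni; exists i.
exists F => K clK ncK v.
have [i ei] := eP ([set s | exists2 x, K x & mkseq x (size s) = s], v).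
have KE : branches (e i).1 = K by rewrite ei /= branchesK.
exists (p i); last by rewrite (FP (p i) i) ?KE// ei.
by rewrite -KE; apply: (pP i _).1; rewrite KE.
Qed.

(** * Heights of FLS spaces *)

Definition is_FLS_height (a : ordinal_number) :=
  exists X : topologicalType, FLS X /\ is_height X a.

Lemma is_FLS_height_iso a b : oiso a b -> is_FLS_height a -> is_FLS_height b.
Proof.
by move=> ab [X [flsX ha]]; exists X; split=> //; exact: is_height_iso ha.
Qed.

Definition one_point : topologicalType := discrete_topology unit.

Lemma one_pointE (x : one_point) : x = tt.
Proof. by case: x. Qed.

Lemma FLS_one_point : FLS one_point.
Proof.
split.
- by move=> x y _; rewrite (one_pointE x) (one_pointE y).
- move=> x; exists [set setT]; first exact: countable1.
  split=> [_ ->|U Ux]; first exact: filterT.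
  exists setT => // y _; rewrite (one_pointE y) -(one_pointE x).
  exact: nbhs_singleton.
- move=> C _ CT; have : [set: one_point] tt by [].
  rewrite -CT => -[V CV Vt]; exists [set V]; split=> [_ ->//||].
    exact: countable1.
  by apply/seteqP; split=> // x _; exists V => //; rewrite (one_pointE x).
- move=> A [x Ax]; exists x; apply/isolatedP; split=> //.
  exists setT; split=> [|//|y _]; first exact: openT.
  by rewrite (one_pointE y) (one_pointE x).
Qed.

Lemma height_one_point : is_height one_point (oaddn ozero 1).
Proof.
split=> [|b b0].
  rewrite [oaddn _ _]/= cb_deriv_succ cb_deriv0; apply/seteqP; split=> // x [_].
  apply; apply/isolatedP; split=> //.
  exists setT; split=> [|//|y _]; first exact: openT.
  by rewrite (one_pointE y) (one_pointE x).
apply/osucc_leE/oltNge => /cb_derivS => /(_ one_point).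
by rewrite b0 cb_deriv0 => /(_ tt) -/(_ I).
Qed.

Lemma is_FLS_height1 : is_FLS_height (oaddn ozero 1).
Proof.
by exists one_point; split; [exact: FLS_one_point|exact: height_one_point].
Qed.

(** The height of the layered space with the spaces [X y] over the indices of
    rank [0], and single points over the others, is located between the heights
    [h y] and a bound depending on the ranks; this determines it whenever the two
    ends meet or an independent argument excludes the remaining values. *)
Lemma layered_space (Y : Type) (phi : Y -> nat -> bool) (r : Y -> nat)
    (X : Y -> topologicalType) (h : Y -> ordinal_number) (a : ordinal_number) :
  injective phi ->
  (forall k : Y -> nat, countable [set y | forall x, (r y < r x)%N ->
    ~ agree (k x) (phi y) (phi x)]) ->
  (forall y, [/\ FLS (X y), is_height (X y) (h y) & ole (h y) a]) ->
  exists (Z : topologicalType) (b : ordinal_number),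
    [/\ FLS Z, is_height Z b,
        forall y, r y = 0 -> ole (h y) b /\ [set: X y] #<= [set: Z],
        forall c, (forall y, ole (oaddn a (r y)) c) -> ole b c &
        (forall y, [set: X y] !=set0) -> [set: Y] #<= [set: Z]].
Proof.
move=> phi_inj cov XP.
pose X' y : topologicalType := if r y is 0 then X y else one_point.
have X'E y : r y = 0 -> X' y = X y by rewrite /X' => ->.
have X'1 y : (0 < r y)%N -> exists x0 : X' y, forall x, x = x0.
  rewrite /X'; case: (r y) => // n _; exists tt; exact: one_pointE.
have flsX' y : FLS (X' y).
  by rewrite /X'; case: (r y) => [|_]; [case: (XP y)|exact: FLS_one_point].
pose Z : topologicalType := layered phi r X'.
have flsZ : FLS Z by exact: layered_FLS.
exists Z, (scattered_height Z).
have hZ : is_height Z (scattered_height Z).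
  by apply: scattered_heightP; case: flsZ.
split=> //.
- move=> y ry; split; last first.
    rewrite -X'E//; apply: (@inj_card_leT _ _ (existT _ y)) => x x'.
    exact: existT_injr.
  apply/oleNgt => lt; have [_ hX _] := XP y.
  have [x bx] : cb_deriv (X' y) (scattered_height Z) !=set0.
    by rewrite X'E//; exact: is_height_lt lt.
  by have := @fibre_deriv _ phi r X' y x _ bx; case: hZ => ->.
- move=> c ac; apply: hZ.2; apply/seteqP; split=> // z cz.
  have a0 y : r y = 0 -> cb_deriv (X' y) a = set0.
    move=> ry; rewrite X'E//; have [_ [h0 _] /cb_derivS ha] := XP y.
    by apply/seteqP; split=> // x /ha; rewrite h0.
  have := layered_deriv_rank X'1 a0 (cb_derivS (ac (projT1 z)) cz).
  by rewrite ltnn.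
- move=> ne; have /choice[f fP] (y : Y) : exists z : Z, projT1 z = y.
    have [x _] : [set: X' y] !=set0.
      by rewrite /X'; case: (r y) => [|_]; [exact: ne|exists tt].
    by exists (existT _ y x).
  by apply: (@inj_card_leT _ _ f) => y y' yy'; rewrite -(fP y) -(fP y') yy'.
Qed.

(** A new point, of rank [1], is made the limit of a sequence of copies of the
    space. *)
Lemma is_FLS_height_succ a : is_FLS_height a -> is_FLS_height (osucc a).
Proof.
move=> [X0 [flsX0 hX0]].
pose phi (y : option nat) (i : nat) := if y is Some n then i == n else false.
pose r (y : option nat) := if y is Some n then 0 else 1.
pose X (y : option nat) := if y is Some n then X0 else one_point.
have X1 y : (0 < r y)%N -> exists x0 : X y, forall x, x = x0.
  by case: y => // _; exists tt; exact: one_pointE.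
pose Z : topologicalType := layered phi r X; exists Z; split.
  apply: layered_FLS => // [|y].
  - case=> [n|] [m|] // /funeqP E.
    + by have /= := E n; rewrite eqxx => /esym/eqP ->.
    + by have /= := E n; rewrite eqxx.
    + by have /= := E m; rewrite eqxx.
  - by case: y => [n|]; [|exact: FLS_one_point].
(* The new point survives as long as the copies do. *)
have infE b : ole b a -> cb_deriv Z b (existT _ None tt).
  elim/(well_founded_ind olt_wf): b => b IH ba; rewrite cb_derivE => c cb.
  have ca := olt_ole_trans cb ba; split; first by apply: IH => //; left.
  move=> /isolatedP[_ [V [oV Vi VA]]].
  have [_ /(_ _ Vi)[k kV]] : layered_open V by [].
  have [x cx] := is_height_lt hX0 ca.
  have cz : cb_deriv Z c (existT _ (Some k) x) by exact: fibre_deriv.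
  have : V (existT _ (Some k) x).
    by apply: kV => // i ik /=; rewrite ltn_eqF.
  by move=> Vz; have := VA _ (conj Vz cz) => /(congr1 (@projT1 _ _)).
split=> [|b b0]; last first.
  apply/osucc_leE/oltNge => ba.
  by have := infE _ ba; rewrite b0.
apply/seteqP; split=> // z.
have a0 y : r y = 0 -> cb_deriv (X y) a = set0 by case: y => //= n _; case: hX0.
by move=> /(@layered_deriv_rank _ phi r X X1 a 1 a0); case: z => -[].
Qed.

(** A space of each FLS height below [a] is inserted over some point of rank [0]
    of the Cantor space, which is cut into layers that meet every uncountable
    closed set.  The resulting height is at most the least ordinal above all
    [oseg b + n], hence at most [a]; it is not below [a], since its successor
    would then be one of the inserted heights. *)
Lemma is_FLS_height_bounded a : limit_ordinal a -> olt ozero a ->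
  olt a (csucc continuum) ->
  (exists b : a, forall c, is_FLS_height c -> olt c a -> ~ olt (oseg b) c) ->
  is_FLS_height a.
Proof.
move=> lima a0 ac [b bP].
pose W := {x : a | is_FLS_height (oseg x)}.
have /oltP[x1 x1E] := limit_succ_lt lima a0.
have hx1 : is_FLS_height (oseg x1).
  exact: is_FLS_height_iso (oiso_sym x1E) is_FLS_height1.
have cW : [set: nat * W] #<= [set: set nat].
  apply: card_prod_continuum.
    apply: (@inj_card_leT _ _ (fun n => [set n])) => n m.
    by move=> /seteqP[/(_ n)] /(_ erefl).
  move/olt_csuccP: ac; apply: card_le_trans.
  apply: (@inj_card_leT _ _ (fun w : W => sval w)); exact: sval_inj.
have [F FP] := bernstein (0, exist _ x1 hx1 : W) cW.
have /choice[X XP] (y : nat -> bool) := svalP (F y).2.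
have [||y|Z [c [flsZ hZ cge cle _]]] :=
  @layered_space (nat -> bool) id (fun y => (F y).1) X
    (fun y => oseg (sval (F y).2)) (oseg b).
- by [].
- (* The points of rank [m] left uncovered lie in the closed set [K m], which
     has no point of rank [m.+1] and is therefore countable. *)
  move=> k; set E := (E in countable E).
  pose K m := [set y | forall x, (m < (F x).1)%N -> ~ agree (k x) y x].
  apply: (@sub_countable _ _ _ (\bigcup_m K m)).
    by apply: subset_card_le => y Ey; exists (F y).1 => // x; exact: Ey.
  apply: bigcup_countable => [|m _]; first exact: countableP.
  apply: contrapT => ncK.
  have [|x Kx Fx] := FP (K m) _ ncK (m.+1, exist _ x1 hx1 : W).
    move=> y cly x mx yx; have [y' Ky' yy'] := cly (k x).
    by apply: (Ky' x mx); exact: agree_trans (agree_sym yy') yx.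
  by apply: (Kx x); rewrite ?Fx.
- have [? ?] := XP y; split=> //.
  by apply/oleNgt; apply: bP; [exact: (svalP (F y).2)|exact: olt_seg].
have ca : ole c a.
  apply: cle => y; left; elim: (F y).1 => [|n IH]; first exact: olt_seg.
  exact: limit_succ_lt.
have Hc : is_FLS_height c by exists Z.
case: ca => [ca|]; last by move/is_FLS_height_iso; apply.
have /oltP[x xc] := limit_succ_lt lima ca.
have hx : is_FLS_height (oseg x).
  exact: is_FLS_height_iso (oiso_sym xc) (is_FLS_height_succ Hc).
have [||y _ Fy] := FP setT _ _ (0, exist _ x hx : W).
- by [].
- exact: uncountable_cantor.
have [] := cge y; rewrite Fy //= => xlec _; exfalso.
apply: (@olt_irr c); apply: olt_ole_trans xlec.
exact: olt_iso (olt_succ c) (oiso_sym xc).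
Qed.

Lemma oaddn_mono a m n : (m <= n)%N -> ole (oaddn a m) (oaddn a n).
Proof. by move=> /subnK <-; rewrite /oaddn iterD; exact: ole_oaddn. Qed.

(** Inserting spaces of heights cofinal in [a] forces the height up to [a]. *)
Lemma layered_cofinal (Y : Type) (phi : Y -> nat -> bool) (r : Y -> nat)
    (a : ordinal_number) (g : Y -> a) (n : nat) :
  injective phi ->
  (forall k : Y -> nat, countable [set y | forall x, (r y < r x)%N ->
    ~ agree (k x) (phi y) (phi x)]) ->
  (forall b : a, exists c, [/\ is_FLS_height c, olt c a & olt (oseg b) c]) ->
  cofinal (g @` [set y | r y = 0]) -> (forall y, (r y <= n)%N) ->
  exists c, [/\ is_FLS_height c, ole a c & ole c (oaddn a n)].
Proof.
move=> phi_inj cov /choice[h hP] cofg rn.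
have /choice[X XP] (y : Y) : exists X : topologicalType,
  FLS X /\ is_height X (h (g y)) by have [] := hP (g y).
have [y|Z [c [flsZ hZ cge cle _]]] :=
  @layered_space Y phi r X (h \o g) a phi_inj cov.
  by have [? ?] := XP y; split=> //; left; have [] := hP (g y).
exists c; split; [by exists Z| |]; last by apply: cle => y; exact: oaddn_mono.
apply/oleNgt => /oltP[x xc]; have [_ [y ry <-] xy] := cofg x.
have [_ _ hy] := hP (g y); have [hc _] := cge y ry.
apply: (@olt_irr (oseg x)); apply: olt_iso (oiso_sym xc).
apply: olt_ole_trans hc; apply: ole_lt_trans hy.
by apply/oleNgt => /olt_osegE; rewrite xy.
Qed.

(** If the FLS heights below [a] are cofinal in [a], countably many of them
    already are, and the sum of the corresponding spaces has height [a]. *)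
Lemma is_FLS_height_limit a : limit_ordinal a -> olt ozero a ->
  olt a (csucc continuum) -> ole (cf a) omega -> is_FLS_height a.
Proof.
move=> lima a0 ac cfa.
have [[b bP]|nb] := pselect (exists b : a,
  forall c, is_FLS_height c -> olt c a -> ~ olt (oseg b) c).
  by apply: is_FLS_height_bounded => //; exists b.
have {nb} above (b : a) :
    exists c, [/\ is_FLS_height c, olt c a & olt (oseg b) c].
  apply: contrapT => nc; apply: nb; exists b => c hc ca bc.
  by apply: nc; exists c.
have [A cofA Acf] := cf_cofinal a.
have cA : countable A.
  by rewrite /countable (card_le_eql Acf); exact: (@ole_card _ omega).
have /oltP[x0 _] := a0; have [y0 Ay0 _] := cofA x0.
have /pfcard_geP[A0|/surjfunPex[e Ae]] := cA; first by rewrite A0 in Ay0.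
have [||||//|c [hc ac' ca]] :=
  @layered_cofinal nat (fun n i => i == n) (fun=> 0) a e 0.
- by move=> n m /funeqP/(_ n); rewrite eqxx => /esym/eqP.
- by move=> k; exact: countableP.
- exact: above.
- by rewrite (_ : [set y | _] = setT) -?Ae//; apply/seteqP; split.
exact: is_FLS_height_iso (ole_anti ca ac') hc.
Qed.

(** * The tree of finite sequences with a K-Lusin set of branches *)

Section LusinTree.
Variable L : set baire.

Definition lusin_tree : Type := (seq nat + {f : baire | L f})%type.

(** A finite sequence has only its initial segments as prefixes, so that the
    codes of the branches [f] through [s] tend to the code of [s] as [f (size s)]
    tends to infinity. *)
Definition prefixes (y : lusin_tree) : set (seq nat) := match y with
  | inl s => [set t | t = take (size t) s]
  | inr f => [set t | t = mkseq (sval f) (size t)]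
  end.

Definition tree_code (y : lusin_tree) (i : nat) : bool :=
  `[< exists2 t, prefixes y t & choice.pickle t = i >].

Definition tree_rank (y : lusin_tree) : nat := if y is inl _ then 1 else 0.

Lemma tree_codeE y (t : seq nat) :
  tree_code y (choice.pickle t) <-> prefixes y t.
Proof.
split=> [/asboolP[u yu /(pcan_inj (@choice.pickleK _)) <-//]|yt].
by apply/asboolP; exists t.
Qed.

Lemma tree_code_inj : injective tree_code.
Proof.
move=> y y' yy'.
have {yy'} E t : prefixes y t <-> prefixes y' t by rewrite -!tree_codeE yy'.
case: y y' E => [s|[f Lf]] [s'|[f' Lf']] E.
- have /E /= : prefixes (inl s) s by rewrite /= take_size.
  have /E /= : prefixes (inl s') s' by rewrite /= take_size.
  move=> s's ss'; congr inl; rewrite ss' take_oversize//.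
  by rewrite s's size_take; case: ltnP => // /ltnW.
- have /E : prefixes (inr (exist _ f' Lf')) (mkseq f' (size s).+1).
    by rewrite /prefixes/mkset size_mkseq.
  rewrite /prefixes/mkset => /(congr1 size).
  by rewrite size_take !size_mkseq ltnNge leqnSn /= => /esym/n_Sn.
- have /E : prefixes (inr (exist _ f Lf)) (mkseq f (size s').+1).
    by rewrite /prefixes/mkset size_mkseq.
  rewrite /prefixes/mkset => /(congr1 size).
  by rewrite size_take !size_mkseq ltnNge leqnSn /= => /esym/n_Sn.
- congr inr; apply: sval_inj; apply/funext => n /=.
  have /E : prefixes (inr (exist _ f Lf)) (mkseq f n.+1).
    by rewrite /prefixes/mkset size_mkseq.
  rewrite /prefixes/mkset size_mkseq => /(congr1 (fun s => nth 0 s n)).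
  by rewrite !nth_mkseq.
Qed.

(** A branch through a finitely branching tree is bounded by a function that
    depends on the tree only. *)
Lemma finitely_branching_bound (b : seq nat -> nat) :
  exists G : nat -> nat, forall f : nat -> nat,
    (forall n, f n <= b (mkseq f n))%N -> forall n, (f n <= G n)%N.
Proof.
pose fix lvl n := if n is m.+1
  then [seq rcons s i | s <- lvl m, i <- iota 0 (b s).+1] else [:: [::]].
exists (fun n => \max_(s <- lvl n) b s) => f fb n.
have lvlS m :
  lvl m.+1 = [seq rcons s i | s <- lvl m, i <- iota 0 (b s).+1] by [].
have lf : mkseq f n \in lvl n.
  elim: n => [|n IH]; first by rewrite inE.
  rewrite lvlS mkseqS; apply/allpairsPdep.
  by exists (mkseq f n), (f n); rewrite mem_iota /= ltnS.
by apply: leq_trans (fb n) _; exact: leq_bigmax_seq.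
Qed.

(** The functions bounded by [G] form a compact set by Tychonoff's theorem. *)
Lemma K_Lusin_bounded (G : nat -> nat) : K_Lusin L ->
  countable ([set f : baire | forall n, (f n <= G n)%N] `&` L).
Proof.
move=> KL; apply: KL.
apply: (@tychonoff nat (fun=> nat) (fun n => [set i | (i <= G n)%N])) => n.
apply: finite_compact.
by apply: sub_finite_set (finite_II (G n).+1) => i.
Qed.

(** If the branch [f] avoids the neighbourhood of [mkseq f n] given by [k], then
    [f n] is at most the largest [n]-th entry of the finitely many sequences
    that this neighbourhood constrains; so the exceptional branches run through
    a finitely branching tree. *)
Lemma lusin_tree_cover : K_Lusin L -> forall k : lusin_tree -> nat,
  countable [set y | forall x, (tree_rank y < tree_rank x)%N ->
    ~ agree (k x) (tree_code y) (tree_code x)].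
Proof.
move=> KL k.
pose entry (s : seq nat) i :=
  if choice.unpickle i is Some t then nth 0 t (size s) else 0.
pose b (s : seq nat) := \max_(i < k (inl s)) entry s i.
have [G GP] := finitely_branching_bound b.
apply: (@sub_countable _ _ _ (range inl `|`
   [set y | exists2 f : {f | L f}, y = inr f & forall n, (sval f n <= G n)%N])).
  apply: subset_card_le => -[s|[f Lf]] yP; [by left; exists s|right].
  exists (exist _ f Lf) => //=; apply: GP => n.
  rewrite leqNgt; apply/negP => bf.
  apply: (yP (inl (mkseq f n))) => // i ik.
  have take_prefix m : (m <= n)%N -> take m (mkseq f n) = mkseq f m.
    by move=> mn; rewrite /mkseq -map_take take_iota (minn_idPl mn).
  apply/idP/idP => /asboolP[t tP ti]; apply/asboolP; exists t => //.
    rewrite /= take_prefix//; rewrite leqNgt; apply/negP => nt.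
    have le : (entry (mkseq f n) i <= b (mkseq f n))%N.
      pose ent (j : 'I_(k (inl (mkseq f n)))) := entry (mkseq f n) j.
      exact: (leq_bigmax (F := ent) (Ordinal ik)).
    have := leq_ltn_trans le bf; rewrite /entry -ti choice.pickleK.
    by rewrite size_mkseq tP nth_mkseq// ltnn.
  have tn : (size t <= n)%N.
    have := congr1 size tP; rewrite size_take size_mkseq.
    by case: ltnP => [/ltnW//|_ ->].
  by move: tP; rewrite /= take_prefix.
apply: countableU.
  exact: sub_countable (card_image_le _ _) (countableP _).
set B := [set f : {f | L f} | forall n, (sval f n <= G n)%N].
apply: (@sub_countable _ _ _ (inr @` B)).
  by apply: subset_card_le => _ [f -> fB]; exists f.
apply: sub_countable (card_image_le _ _) _.
rewrite -(eq_countable (@inj_card_eq _ _ B _ (in2W (@sval_inj _ _)))).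
apply: sub_countable (K_Lusin_bounded G KL).
by apply: subset_card_le => _ [f fB <-]; split=> //; exact: svalP.
Qed.

End LusinTree.

(** * The equivalence *)

Section FromLusin.
Variable L : set baire.
Hypotheses (KL : K_Lusin L) (cardL : L #= [set: dnum]).

Let tree_layers := @lusin_tree_cover L KL.

Lemma uncountable_Lusin : ~ countable L.
Proof.
have [D domD Dd] := dnumP; move=> cL; apply: (dominating_uncountable domD).
by rewrite /countable (card_le_eql Dd) -(card_le_eql cardL).
Qed.

Lemma uncountable_FLS_height2 :
  exists (X : topologicalType) (a : ordinal_number),
  [/\ FLS X, is_height X a, ole a (oaddn ozero 2) & ~ countable [set: X]].
Proof.
have [|Z [a [flsZ hZ _ cle cY]]] := @layered_space (lusin_tree L) _ _
    (fun=> one_point) (fun=> oaddn ozero 1) (oaddn ozero 1)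
    (@tree_code_inj L) tree_layers.
  move=> _; split; last exact: ole_refl; first exact: FLS_one_point.
  exact: height_one_point.
exists Z, a; split=> //.
  by apply: cle => -[_|_] //=; [exact: ole_refl|left; exact: olt_succ].
move=> cZ; apply: uncountable_Lusin; rewrite /countable.
rewrite -(card_le_eql (card_sig L)); apply: card_le_trans cZ.
apply: card_le_trans (cY _); last by move=> _; exists tt.
by apply: (@inj_card_leT _ _ inr) => f g [].
Qed.

(** For a limit [a] of uncountable cofinality the layered space has a height
    between [a] and [a + 1], and [a] itself is excluded since heights have
    countable cofinality. *)
Lemma is_FLS_height_succ_limit a : limit_ordinal a -> olt ozero a ->
  olt a (csucc continuum) -> ole (cf a) dnum -> is_FLS_height (osucc a).
Proof.
move=> lima a0 ac cfa.
have [cfo|ncfo] := pselect (ole (cf a) omega).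
  by apply: is_FLS_height_succ; exact: is_FLS_height_limit.
have above (b : a) : exists c, [/\ is_FLS_height c, olt c a & olt (oseg b) c].
  apply: contrapT => nc; apply: ncfo.
  have [|X [flsX hX]] := is_FLS_height_bounded lima a0 ac.
    by exists b => c hc ca bc; apply: nc; exists c.
  exact: cf_height hX.
have [A cofA Acf] := cf_cofinal a.
have /oltP[x0 _] := a0; have [y0 Ay0 _] := cofA x0.
have : [set: {x | A x}] #<= [set: {f | L f}].
  rewrite (card_le_eql (card_sig A)) (card_le_eqr (card_sig L)).
  by rewrite (card_le_eql Acf) (card_le_eqr cardL); exact: ole_card.
move=> /(card_leT_surj (exist _ y0 Ay0))[g gP].
pose g' (y : lusin_tree L) : a := if y is inr f then sval (g f) else y0.
have [|y|c [hc lec cle]] := @layered_cofinal (lusin_tree L) _ _ a g' 1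
  (@tree_code_inj L) tree_layers above.
- move=> x; have [y Ay xy] := cofA x; exists y => //.
  by have [f fy] := gP (exist _ y Ay); exists (inr f) => //=; rewrite fy.
- by case: y.
have [//|ca] := lec; last first.
  case: hc => X [flsX hX]; case: ncfo.
  exact: cf_iso_le (oiso_sym ca) (cf_height flsX hX).
by move/osucc_leE => aC; apply: is_FLS_height_iso (ole_anti cle aC) hc.
Qed.

Lemma is_FLS_height_oaddn a n : limit_ordinal a -> olt a (csucc continuum) ->
  ole (cf a) dnum -> is_FLS_height (oaddn a n.+1).
Proof.
move=> lima ac cfa; elim: n => [|n]; last exact: is_FLS_height_succ.
have [a0|/oleNgt] := pselect (olt ozero a).
  exact: is_FLS_height_succ_limit.
case=> [[x _]|a0]; first by case: x.
exact: is_FLS_height_iso (osucc_iso (oiso_sym a0)) is_FLS_height1.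
Qed.

(** A disjoint summand of height at most [2] does not change the height. *)
Lemma uncountable_FLS_of_height a : is_FLS_height a -> ole (oaddn ozero 2) a ->
  exists X : topologicalType, [/\ FLS X, ~ countable [set: X] & is_height X a].
Proof.
move=> [X1 [fls1 h1]] a2.
have [X2 [b [fls2 h2 b2 nc2]]] := uncountable_FLS_height2.
have [|||Z [c [flsZ hZ cge cle _]]] := @layered_space bool
    (fun b i => b) (fun=> 0)
    (fun i => if i then X1 else X2) (fun i => if i then a else b) a.
- by move=> [] [] // /funeqP/(_ 0).
- by move=> k; exact: countableP.
- case; split=> //; [exact: ole_refl|exact: ole_trans a2].
exists Z; split=> //.
  by move=> cZ; apply: nc2; apply: sub_countable cZ; have [] := cge false erefl.
apply: is_height_iso hZ; apply: ole_anti; last by have [] := cge true erefl.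
by apply: cle => y; exact: ole_refl.
Qed.

End FromLusin.

Theorem corollary6p7 :
  (exists2 L : set baire, K_Lusin L & L #= [set: dnum]) ->
  forall lambda : ordinal_number,
    (exists X : topologicalType,
       [/\ FLS X, ~ countable [set: X] & oiso lambda (scattered_height X)]) <->
    [/\ ole (oaddn ozero 2) lambda,
        olt lambda (csucc continuum),
        ole (cf lambda) omega &
        ole (cf (olim lambda)) dnum].
Proof.
move=> [L KL cardL] a; split=> [[X [flsX ncX /oiso_sym hX]]|[a2 ac cfa cfl]].
  have ha : is_height X a.
    by apply: is_height_iso hX _; apply: scattered_heightP; case: flsX.
  split; [exact: uncountable_height_ge2 ncX|exact: height_lt_csucc ha|
          exact: cf_height ha|exact: cf_olim_height ha].
have ha : is_FLS_height a.
  have [lim [n an]] := olimP a.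
  have lc : olt (olim a) (csucc continuum).
    apply: ole_lt_trans ac; apply: ole_trans (ole_oaddn _ n) _.
    by right; exact: oiso_sym.
  apply: is_FLS_height_iso (oiso_sym an) _.
  case: n an => [|n] an; last exact: is_FLS_height_oaddn cardL _ _ _ _ _.
  apply: is_FLS_height_limit => //; last exact: cf_iso_le an cfa.
  apply: olt_iso an; apply: olt_ole_trans a2.
  exact: olt_trans (olt_succ _) (olt_succ _).
have [X [flsX ncX hX]] := uncountable_FLS_of_height KL cardL ha a2.
exists X; split=> //; apply: is_height_unique hX _.
by apply: scattered_heightP; case: flsX.
Qed.
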